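(* Let $\Phi,\Psi$ be finite sets of first-order predicates over a signature. If for every termlike $\sigma$-algebra $\mathsf U$, every FOLeq algebra $\mathcal L$ over $\mathsf U$ and every interpretation of the signature over $\mathcal L$ one has $\bigwedge\{[\![\phi]\!]\mid\phi\in\Phi\}\le\bigvee\{[\![\psi]\!]\mid\psi\in\Psi\}$, then the sequent $\Phi\vdash\Psi$ is derivable.
   Context: Atoms $\mathbb A$ (countably infinite; $a,b,c$ distinct), permutations, nominal sets, support $\mathrm{supp}$, freshness $a\#x$ ($a\notin\mathrm{supp}(x)$), equivariance, and $\mathsf N a$ (''for all but finitely many $a$'') as standard in nominal techniques. Termlike $\sigma$-algebra $\mathsf U$: nominal set with equivariant $x[a:=u]$ and equivariant injection $\mathrm{atm}:\mathbb A\to\mathsf U$ satisfying $a[a:=x]=x$; $x[a:=a]=x$; $a\#x\Rightarrow x[a:=u]=x$; $b\#x\Rightarrow x[a:=u]=((b\ a)\cdot x)[b:=u]$; $a\#v\Rightarrow x[a:=u][b:=v]=x[b:=v][a:=u[b:=v]]$; a $\sigma$-algebra over $\mathsf U$ is a nominal set with equivariant substitution by elements of $\mathsf U$ satisfying the last four axioms. Simultaneous substitution: rename to fresh atoms then substitute sequentially. FOLeq algebra over $\mathsf U$: a nominal poset (nominal set with equivariant partial order) having all $A\#$limits $\bigwedge^{\#A}X$ (greatest lower bound of finite $X$ among elements whose support avoids finite $A\subseteq\mathbb A$) and $A\#$colimits; distributive ($x\vee(y\wedge z)=(x\vee y)\wedge(x\vee z)$, and $a\#x\Rightarrow x\vee\bigwedge^{\#a}y=\bigwedge^{\#a}(x\vee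 y)$); complemented; a $\sigma$-algebra over $\mathsf U$ whose substitution $[a:=u]$ commutes with $A\#$limits, $A\#$colimits (when $A\cap(\mathrm{supp}(u)\cup\{a\})=\emptyset$) and complements; with an equality element $e=(a=^{\mathcal L}b)$, $\mathrm{supp}(e)\subseteq\{a,b\}$, $e[a:=u,b:=u]=\top$, $e[a:=u,b:=v]\wedge z[a:=u]=e[a:=u,b:=v]\wedge z[a:=v]$. Syntax: terms $r::=a\mid\mathsf f(r_1..r_n)$, predicates $\phi::=\bot\mid r=r\mid\mathsf P(\vec r)\mid\phi\wedge\phi\mid\neg\phi\mid\forall a.\phi$ up to $\alpha$-equivalence; derivability is the standard classical sequent calculus for first-order logic with equality (rules Hyp, $\bot$L, $\wedge$L/R, $\neg$L/R, $\forall$L, $\forall$R with eigenvariable condition, $=$R: from $\Phi,r=r\vdash\Psi$ infer $\Phi\vdash\Psi$, $=$L: from $\Phi,r'=r,\phi[a:=r']\vdash\Psi$ infer $\Phi,r'=r,\phi[a:=r]\vdash\Psi$). Interpretation: equivariant $\mathsf f^{\mathcal I}$ from $n$-tuples of distinct atoms to $\mathsf U$ and $\mathsf P^{\mathcal I}$ to $\mathcal L$, extended to arguments in $\mathsf U$ by $\mathsf f^{\mathcal I}(\vec u)=\mathsf f^{\mathcal I}(\vec a)[\vec a:=\vec u]$ ($\vec a$ fresh), similarly for $\mathsf P$, and $u=^{\mathcal I}v=e[a:=u,b:=v]$; $[\![a]\!]=\mathrm{atm}(a)$, $[\![\mathsf f(\vec r)]\!]=\mathsf f^{\mathcal I}([\![\vec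 r]\!])$, $[\![\bot]\!]=\bot$, $[\![r=s]\!]=[\![r]\!]=^{\mathcal I}[\![s]\!]$, $[\![\mathsf P(\vec r)]\!]=\mathsf P^{\mathcal I}([\![\vec r]\!])$, $\wedge\mapsto\wedge$, $\neg\mapsto\neg$, $[\![\forall a.\phi]\!]=\bigwedge^{\#\{a\}}\{[\![\phi]\!]\}$. *)

(* Defs.v *)
From Stdlib Require List.
From HB Require Import structures.
From mathcomp Require Import all_boot.
From mathcomp Require Import finmap generic_quotient boolp classical_sets.
Set Implicit Arguments.
Unset Strict Implicit.
Unset Printing Implicit Defensive.
Local Open Scope fset_scope.

Definition atom := nat.
HB.instance Definition _ := Countable.on atom.

Record perm := Perm {
  pfun :> atom -> atom;
  pinv : atom -> atom;
  pfunK : cancel pfun pinv;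
  pinvK : cancel pinv pfun;
  pfin : exists A : {fset atom}, forall a, a \notin A -> pfun a = a
}.

Lemma perm1_fin : exists A : {fset atom}, forall a, a \notin A -> id a = a.
Proof. by exists fset0. Qed.

Definition perm1 : perm := @Perm id id (fun=> erefl) (fun=> erefl) perm1_fin.

Lemma permM_fin (p q : perm) :
  exists A : {fset atom}, forall a, a \notin A -> (p \o q) a = a.
Proof.
case: (pfin p) (pfin q) => [A hA] [B hB]; exists (A `|` B) => a.
by rewrite in_fsetU negb_or => /andP[aA aB] /=; rewrite hB ?hA.
Qed.

Definition permM (p q : perm) : perm :=
  @Perm (p \o q) (pinv q \o pinv p) (can_comp (pfunK p) (pfunK q))
    (can_comp (pinvK q) (pinvK p)) (permM_fin p q).

Definition swap_fun (a b c : atom) : atom :=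
  if c == a then b else if c == b then a else c.

Lemma swap_funK a b : cancel (swap_fun a b) (swap_fun a b).
Proof.
move=> c; rewrite /swap_fun; case: (eqVneq c a) => [->|ca].
  by case: (eqVneq b a) => [->|_] //; rewrite eqxx.
case: (eqVneq c b) => [->|cb]; first by rewrite eqxx.
by rewrite (negbTE ca) (negbTE cb).
Qed.

Lemma swap_fin a b :
  exists A : {fset atom}, forall c, c \notin A -> swap_fun a b c = c.
Proof.
exists [fset a; b] => c; rewrite !inE negb_or => /andP[ca cb].
by rewrite /swap_fun (negbTE ca) (negbTE cb).
Qed.

Definition swap (a b : atom) : perm :=
  Perm (@swap_funK a b) (@swap_funK a b) (swap_fin a b).

Definition supports (X : Type) (act : perm -> X -> X) (A : {fset atom}) (x : X) :=
  forall p : perm, (forall a, a \in A -> p a = a) -> act p x = x.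

Record nomset := NomSet {
  nom_sort :> Type;
  act : perm -> nom_sort -> nom_sort;
  act1 : forall x, act perm1 x = x;
  actM : forall p q x, act (permM p q) x = act p (act q x);
  act_fin : forall x, exists A, supports act A x
}.

(* The intersection of all finite supports of [x]. *)
Definition supp (X : nomset) (x : X) : set atom :=
  fun a => forall A : {fset atom}, supports (@act X) A x -> a \in A.

Definition fresh (X : nomset) (a : atom) (x : X) : Prop := ~ supp x a.

Definition fresh_for (X : nomset) (A : {fset atom}) (x : X) : Prop :=
  forall a, a \in A -> fresh a x.

Record sigma_laws (X U : nomset) (sub : X -> atom -> U -> X)
    (subU : U -> atom -> U -> U) (atm : atom -> U) : Prop := SigmaLaws {
  sub_equiv : forall p x a u, act p (sub x a u) = sub (act p x) (p a) (act p u);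
  sub_id : forall a x, sub x a (atm a) = x;
  sub_fresh : forall a x u, fresh a x -> sub x a u = x;
  sub_alpha : forall a b x u, a <> b -> fresh b x ->
    sub x a u = sub (act (swap b a) x) b u;
  sub_sub : forall a b x u v, a <> b -> fresh a v ->
    sub (sub x a u) b v = sub (sub x b v) a (subU u b v)
}.

Record termlike := Termlike {
  tl_nom :> nomset;
  atm : atom -> tl_nom;
  tsub : tl_nom -> atom -> tl_nom -> tl_nom;
  atm_equiv : forall p a, act p (atm a) = atm (p a);
  atm_inj : injective atm;
  tsub_atm : forall a x, tsub (atm a) a x = x;
  tsub_laws : sigma_laws tsub tsub atm
}.

Record sigma_alg (U : termlike) := SigmaAlg {
  sa_nom :> nomset;
  ssub : sa_nom -> atom -> U -> sa_nom;
  ssub_laws : sigma_laws ssub (@tsub U) (@atm U)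
}.

(* Distinct atoms outside [avoid]; they exist as soon as [avoid] is finite, which
   is the case wherever this is used. *)
Definition fresh_tuple (n : nat) (avoid : set atom) : n.-tuple atom :=
  xget (nseq_tuple n 0)
    (fun t : n.-tuple atom => uniq t /\ forall c, c \in t -> ~ avoid c).

(* x[a1:=u1,..,an:=un] is ((c1 a1)..(cn an) x)[c1:=u1]..[cn:=un] for distinct
   c1,..,cn fresh for x, a1,..,an, u1,..,un; by equivariance and the sigma-laws
   the result does not depend on which such c1,..,cn are chosen. *)
Definition simsub (X U : nomset) (sub : X -> atom -> U -> X) (n : nat)
    (x : X) (s : n.-tuple atom) (us : n.-tuple U) : X :=
  let cs := fresh_tuple n (fun c =>
    [\/ supp x c, c \in s | exists i, supp (tnth us i) c]) in
  foldl (fun y cu => sub y cu.1 cu.2)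
    (foldr (fun ca y => act (swap ca.1 ca.2) y) x (zip cs s))
    (zip cs us).

(* The A#limit of the finite set underlying [X]. The A#colimit is the same notion
   for the reverse order. *)
Definition is_limit (L : nomset) (le : L -> L -> Prop) (A : {fset atom})
    (X : seq L) (x : L) : Prop :=
  [/\ fresh_for A x,
      forall y, List.In y X -> le x y
    & forall z, fresh_for A z -> (forall y, List.In y X -> le z y) -> le z x].

(* A#limits, A#colimits and complements are unique when they exist, so having them
   is the same as carrying the operations [flim], [fcolim] and [fcompl]. Binary
   meets and joins, top and bottom are the instances with A empty. *)
Record foleq (U : termlike) := FOLeq {
  fol_sigma :> sigma_alg U;
  fle : fol_sigma -> fol_sigma -> Prop;
  fle_equiv : forall p x y, fle x y -> fle (act p x) (act p y);
  fle_refl : forall x, fle x x;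
  fle_anti : forall x y, fle x y -> fle y x -> x = y;
  fle_trans : forall x y z, fle x y -> fle y z -> fle x z;
  flim : {fset atom} -> seq fol_sigma -> fol_sigma;
  flimP : forall A X, is_limit fle A X (flim A X);
  fcolim : {fset atom} -> seq fol_sigma -> fol_sigma;
  fcolimP : forall A X, is_limit (fun x y => fle y x) A X (fcolim A X);
  fjoin_meet : forall x y z,
    fcolim fset0 [:: x; flim fset0 [:: y; z]]
    = flim fset0 [:: fcolim fset0 [:: x; y]; fcolim fset0 [:: x; z]];
  fjoin_lim : forall a x y, fresh a x ->
    fcolim fset0 [:: x; flim [fset a] [:: y]]
    = flim [fset a] [:: fcolim fset0 [:: x; y]];
  fcompl : fol_sigma -> fol_sigma;
  fmeet_compl : forall x, flim fset0 [:: x; fcompl x] = fcolim fset0 [::];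
  fjoin_compl : forall x, fcolim fset0 [:: x; fcompl x] = flim fset0 [::];
  fsub_lim : forall A X a u, a \notin A -> fresh_for A u ->
    ssub (flim A X) a u = flim A [seq ssub x a u | x <- X];
  fsub_colim : forall A X a u, a \notin A -> fresh_for A u ->
    ssub (fcolim A X) a u = fcolim A [seq ssub x a u | x <- X];
  fsub_compl : forall x a u, ssub (fcompl x) a u = fcompl (ssub x a u);
  (* the element a =^L b, for some distinct atoms a and b *)
  feq_a : atom;
  feq_b : atom;
  feq_ab : feq_a <> feq_b;
  feq : fol_sigma;
  feq_supp : forall c, supp feq c -> c = feq_a \/ c = feq_b;
  feq_refl : forall u : U,
    simsub (@ssub U fol_sigma) feq [tuple feq_a; feq_b] [tuple u; u]
    = flim fset0 [::];
  feq_subst : forall (u v : U) (z : fol_sigma),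
    let e := simsub (@ssub U fol_sigma) feq [tuple feq_a; feq_b] [tuple u; v] in
    flim fset0 [:: e; ssub z feq_a u] = flim fset0 [:: e; ssub z feq_a v]
}.

Record signature := Signature {
  fsym : Type;
  psym : Type;
  far : fsym -> nat;
  par : psym -> nat
}.

Inductive term (S : signature) :=
| TAtm of atom
| TApp (f : fsym S) of {ffun 'I_(far f) -> term S}.
Arguments TAtm {S}.

(* Predicates before the quotient by alpha-equivalence. *)
Inductive rpred (S : signature) :=
| RBot
| REq of term S & term S
| RRel (P : psym S) of {ffun 'I_(par P) -> term S}
| RAnd of rpred S & rpred S
| RNot of rpred S
| RAll of atom & rpred S.
Arguments RBot {S}.

Fixpoint tact S (p : perm) (t : term S) : term S :=
  match t with
  | TAtm a => TAtm (p a)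
  | TApp f ts => TApp [ffun i => tact p (ts i)]
  end.

Fixpoint ract S (p : perm) (F : rpred S) : rpred S :=
  match F with
  | RBot => RBot
  | REq r s => REq (tact p r) (tact p s)
  | RRel P ts => RRel [ffun i => tact p (ts i)]
  | RAnd F1 F2 => RAnd (ract p F1) (ract p F2)
  | RNot F1 => RNot (ract p F1)
  | RAll a F1 => RAll (p a) (ract p F1)
  end.

Fixpoint tfv S (t : term S) : {fset atom} :=
  match t with
  | TAtm a => [fset a]
  | TApp f ts => \bigcup_(i <- enum 'I_(far f)) tfv (ts i)
  end.

Fixpoint rfv S (F : rpred S) : {fset atom} :=
  match F with
  | RBot => fset0
  | REq r s => tfv r `|` tfv s
  | RRel P ts => \bigcup_(i <- enum 'I_(par P)) tfv (ts i)
  | RAnd F1 F2 => rfv F1 `|` rfv F2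
  | RNot F1 => rfv F1
  | RAll a F1 => rfv F1 `\ a
  end.

(* alpha-equivalence: the least congruence renaming bound atoms *)
Inductive aeq S : rpred S -> rpred S -> Prop :=
| aeq_refl F : aeq F F
| aeq_sym F G : aeq F G -> aeq G F
| aeq_trans F G H : aeq F G -> aeq G H -> aeq F H
| aeq_and F F' G G' : aeq F F' -> aeq G G' -> aeq (RAnd F G) (RAnd F' G')
| aeq_not F F' : aeq F F' -> aeq (RNot F) (RNot F')
| aeq_all a F F' : aeq F F' -> aeq (RAll a F) (RAll a F')
| aeq_rename a b F : b \notin rfv F -> aeq (RAll a F) (RAll b (ract (swap b a) F)).

HB.instance Definition _ S := gen_eqMixin (rpred S).
HB.instance Definition _ S := gen_choiceMixin (rpred S).

Definition aeqb S : rel (rpred S) := fun F G => `[< aeq F G >].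

Lemma aeqb_refl S : reflexive (@aeqb S).
Proof. by move=> F; apply/asboolP; apply: aeq_refl. Qed.

Lemma aeqb_sym S : symmetric (@aeqb S).
Proof. by move=> F G; apply/asboolP/asboolP; apply: aeq_sym. Qed.

Lemma aeqb_trans S : transitive (@aeqb S).
Proof.
by move=> G F H /asboolP FG /asboolP GH; apply/asboolP; apply: aeq_trans GH.
Qed.

Canonical aeqb_equiv S :=
  EquivRel (@aeqb S) (@aeqb_refl S) (@aeqb_sym S) (@aeqb_trans S).

Definition pred_of (S : signature) := {eq_quot (@aeqb S)}%qT.
HB.instance Definition _ S := Choice.on (pred_of S).
HB.instance Definition _ S := EqQuotient.on (pred_of S).

(* [rfv], [rsubst] (up to alpha-equivalence) and the denotation [rden] below all
   respect [aeq], so reading them off the representative [repr F] is harmless. *)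
Definition pcls S (F : rpred S) : pred_of S := (\pi_(pred_of S) F)%qT.

Definition pbot S : pred_of S := pcls RBot.
Definition peq S (r s : term S) : pred_of S := pcls (REq r s).
Definition pand S (F G : pred_of S) : pred_of S := pcls (RAnd (repr F) (repr G)).
Definition pnot S (F : pred_of S) : pred_of S := pcls (RNot (repr F)).
Definition pall S (a : atom) (F : pred_of S) : pred_of S := pcls (RAll a (repr F)).
Definition pfv S (F : pred_of S) : {fset atom} := rfv (repr F).

Fixpoint tsubst S (th : atom -> term S) (t : term S) : term S :=
  match t with
  | TAtm a => th a
  | TApp f ts => TApp [ffun i => tsubst th (ts i)]
  end.

Definition upd S (th : atom -> term S) (a : atom) (r : term S) : atom -> term S :=
  fun b => if b == a then r else th b.

Definition new_atom (A : {fset atom}) : atom := (\max_(a <- A) a).+1.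

(* Capture-avoiding parallel substitution; the bound atom is always renamed to
   one that is not free in any of the terms substituted under the binder. *)
Fixpoint rsubst S (th : atom -> term S) (F : rpred S) : rpred S :=
  match F with
  | RBot => RBot
  | REq r s => REq (tsubst th r) (tsubst th s)
  | RRel P ts => RRel [ffun i => tsubst th (ts i)]
  | RAnd F1 F2 => RAnd (rsubst th F1) (rsubst th F2)
  | RNot F1 => RNot (rsubst th F1)
  | RAll a F1 =>
      let c := new_atom (\bigcup_(b <- rfv F1 `\ a) tfv (th b)) in
      RAll c (rsubst (upd th a (TAtm c)) F1)
  end.

Definition psubst S (F : pred_of S) (a : atom) (r : term S) : pred_of S :=
  pcls (rsubst (upd TAtm a r) (repr F)).

(* Contexts are finite sets, so a rule may keep its principal predicate. *)
Inductive derivable S : {fset pred_of S} -> {fset pred_of S} -> Prop :=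
| d_hyp Phi Psi F : derivable (F |` Phi) (F |` Psi)
| d_botL Phi Psi : derivable (pbot S |` Phi) Psi
| d_andL Phi Psi F G :
    derivable (F |` (G |` Phi)) Psi -> derivable (pand F G |` Phi) Psi
| d_andR Phi Psi F G :
    derivable Phi (F |` Psi) -> derivable Phi (G |` Psi) ->
    derivable Phi (pand F G |` Psi)
| d_notL Phi Psi F : derivable Phi (F |` Psi) -> derivable (pnot F |` Phi) Psi
| d_notR Phi Psi F : derivable (F |` Phi) Psi -> derivable Phi (pnot F |` Psi)
| d_allL Phi Psi a F r :
    derivable (psubst F a r |` Phi) Psi -> derivable (pall a F |` Phi) Psi
| d_allR Phi Psi a F :
    (forall G, G \in Phi `|` Psi -> a \notin pfv G) ->
    derivable Phi (F |` Psi) -> derivable Phi (pall a F |` Psi)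
| d_eqR Phi Psi r : derivable (peq r r |` Phi) Psi -> derivable Phi Psi
| d_eqL Phi Psi r r' a F :
    derivable (psubst F a r' |` (peq r' r |` Phi)) Psi ->
    derivable (psubst F a r |` (peq r' r |` Phi)) Psi.

Record interp (S : signature) (U : termlike) (L : foleq U) := Interp {
  fint : forall f : fsym S, (far f).-tuple atom -> U;
  pint : forall P : psym S, (par P).-tuple atom -> L;
  (* [fint] and [pint] are only ever used at tuples of distinct atoms. *)
  fint_equiv : forall (p : perm) f (s : (far f).-tuple atom), uniq s ->
    act p (fint s) = fint (map_tuple p s);
  pint_equiv : forall (p : perm) P (s : (par P).-tuple atom), uniq s ->
    act p (pint s) = pint (map_tuple p s)
}.

Definition fresh_args (U : nomset) (n : nat) (us : n.-tuple U) : n.-tuple atom :=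
  fresh_tuple n (fun c => exists i, supp (tnth us i) c).

Definition fext S U (L : foleq U) (I : interp S L) (f : fsym S)
    (us : (far f).-tuple U) : U :=
  simsub (@tsub U) (fint I (fresh_args us)) (fresh_args us) us.

Definition pext S U (L : foleq U) (I : interp S L) (P : psym S)
    (us : (par P).-tuple U) : L :=
  simsub (@ssub U L) (pint I (fresh_args us)) (fresh_args us) us.

Definition eqext U (L : foleq U) (u v : U) : L :=
  simsub (@ssub U L) (feq L) [tuple feq_a L; feq_b L] [tuple u; v].

Fixpoint tden S U (L : foleq U) (I : interp S L) (t : term S) : U :=
  match t with
  | TAtm a => atm U a
  | TApp f ts => fext I [tuple tden I (ts i) | i < far f]
  end.

Fixpoint rden S U (L : foleq U) (I : interp S L) (F : rpred S) : L :=
  match F with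
  | RBot => @fcolim U L fset0 [::]
  | REq r s => eqext L (tden I r) (tden I s)
  | RRel P ts => pext I [tuple tden I (ts i) | i < par P]
  | RAnd F1 F2 => flim fset0 [:: rden I F1; rden I F2]
  | RNot F1 => fcompl (rden I F1)
  | RAll a F1 => flim [fset a] [:: rden I F1]
  end.

Definition pden S U (L : foleq U) (I : interp S L) (F : pred_of S) : L :=
  rden I (repr F).

(* Main.v *)
(** The calculus has no cut rule, so the Lindenbaum algebra is not directly
    available. Instead, an underivable sequent is turned into a classical
    countermodel, and every Tarski structure [M] yields a FOLeq algebra over the
    termlike algebra of terms: its elements are the predicates on valuations
    [atom -> M] that depend on finitely many atoms, freshness means independence,
    and the denotation of a predicate is its satisfaction set.

    The countermodel comes from the rules read bottom-up. Every rule may keep its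
    principal predicate, so an underivable sequent grows, without cut or weakening,
    into an increasing sequence of finite underivable sequents whose union is a
    Hintikka pair. Only terms over the finitely many function symbols of the sequent
    are instantiated, which keeps the construction countable over any signature.
    The model is the set of these terms modulo the equations on the left. *)
From HB Require Import structures.
From mathcomp Require Import all_boot finmap generic_quotient boolp classical_sets.
Require Import Defs.
Set Implicit Arguments.
Unset Strict Implicit.
Unset Printing Implicit Defensive.
Local Open Scope fset_scope.

(** Symbols range over arbitrary types, so equality of terms is decided classically. *)
HB.instance Definition _ S := gen_eqMixin (term S).
HB.instance Definition _ S := gen_choiceMixin (term S).
HB.instance Definition _ S := gen_eqMixin (fsym S).

(** The arguments sit inside a finite function; recursing on each [ts i] gives an induction
    hypothesis for every one of them. *)
Fixpoint term_nested_ind S (P : term S -> Prop)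
    (Patm : forall a, P (TAtm a))
    (Papp : forall f (ts : {ffun 'I_(far f) -> term S}),
       (forall i, P (ts i)) -> P (TApp ts))
    (t : term S) : P t :=
  match t with
  | TAtm a => Patm a
  | TApp f ts => Papp f ts (fun i => term_nested_ind Patm Papp (ts i))
  end.

(** * Atoms, renaming and free atoms *)

Lemma ltn_new_atom (A : {fset atom}) a : a \in A -> (a < new_atom A)%N.
Proof. by move=> aA; exact: (@leq_bigmax_seq atom (enum_fset A) xpredT id _ aA isT). Qed.

Lemma new_atomP (A : {fset atom}) : new_atom A \notin A.
Proof. by apply/negP => /ltn_new_atom; rewrite ltnn. Qed.

Lemma mem_bigcup_enum n (F : 'I_n -> {fset atom}) a :
  (a \in \bigcup_(i <- enum 'I_n) F i) <-> exists i, a \in F i.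
Proof.
split=> [/bigfcupP[i _ ai]|[i ai]]; first by exists i.
by apply/bigfcupP; exists i => //; rewrite mem_enum.
Qed.

Lemma perm_eqLR (p : perm) a b : (p a == b) = (a == pinv p b).
Proof. by rewrite -{2}(pfunK p a) (inj_eq (can_inj (pinvK p))). Qed.

Lemma swapL a b : swap a b a = b.
Proof. by rewrite /= /swap_fun eqxx. Qed.

Lemma swapR a b : swap a b b = a.
Proof. by rewrite /= /swap_fun eqxx; case: eqP. Qed.

Lemma swapD a b c : c != a -> c != b -> swap a b c = c.
Proof. by rewrite /= /swap_fun => /negbTE-> /negbTE->. Qed.

Lemma tact_id S (p : perm) (t : term S) :
  (forall a, a \in tfv t -> p a = a) -> tact p t = t.
Proof.
elim/term_nested_ind: t => [a|f ts IH] /= h; first by rewrite h // inE.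
congr TApp; apply/ffunP => i; rewrite ffunE; apply: IH => a ai; apply: h.
by apply/mem_bigcup_enum; exists i.
Qed.

Lemma tactM S (p q : perm) (t : term S) : tact (permM p q) t = tact p (tact q t).
Proof.
elim/term_nested_ind: t => [a|f ts IH] //=.
by congr TApp; apply/ffunP => i; rewrite !ffunE.
Qed.

Lemma tfv_act S (p : perm) (t : term S) a :
  (a \in tfv (tact p t)) = (pinv p a \in tfv t).
Proof.
elim/term_nested_ind: t => [b|f ts IH] /=; first by rewrite !inE eq_sym perm_eqLR eq_sym.
apply/idP/idP => /mem_bigcup_enum[i ai]; apply/mem_bigcup_enum; exists i.
  by rewrite -IH; move: ai; rewrite ffunE.
by rewrite ffunE IH.
Qed.

Lemma rfv_act S (p : perm) (F : rpred S) a :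
  (a \in rfv (ract p F)) = (pinv p a \in rfv F).
Proof.
elim: F => [|r s|P ts|F IF G IG|F IF|b F IF] /=.
- by rewrite !inE.
- by rewrite !inE !tfv_act.
- apply/idP/idP => /mem_bigcup_enum[i ai]; apply/mem_bigcup_enum; exists i.
    by rewrite -tfv_act; move: ai; rewrite ffunE.
  by rewrite ffunE tfv_act.
- by rewrite !inE IF IG.
- exact: IF.
- by rewrite !inE IF eq_sym perm_eqLR eq_sym.
Qed.

Lemma rfv_aeq S (F G : rpred S) : aeq F G -> rfv F = rfv G.
Proof.
elim=> //= [? ? ? _ -> _ ->|? ? ? ? _ -> _ ->|? ? ? _ ->|a b F0 bF] //.
apply/fsetP => c; rewrite !inE rfv_act /= /swap_fun.
have [->|cb] := eqVneq c b; first by rewrite (negbTE bF) andbF.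
by have [->|ca] := eqVneq c a; rewrite ?(negbTE bF) //.
Qed.

Lemma tsubst_id S (th : atom -> term S) (t : term S) :
  (forall a, a \in tfv t -> th a = TAtm a) -> tsubst th t = t.
Proof.
elim/term_nested_ind: t => [a|f ts IH] /= h; first by rewrite h // inE.
congr TApp; apply/ffunP => i; rewrite ffunE; apply: IH => a ai; apply: h.
by apply/mem_bigcup_enum; exists i.
Qed.

Lemma tsubst_fresh S a (r t : term S) : a \notin tfv t -> tsubst (upd TAtm a r) t = t.
Proof.
move=> at_; apply: tsubst_id => b bt; rewrite /upd; case: eqP => // ba.
by rewrite -ba bt in at_.
Qed.

Definition atomic S (F : rpred S) :=
  match F with RBot | REq _ _ | RRel _ _ => true | _ => false end.

(** Congruence and renaming only relate compound predicates, so an atomic one is alone in its class.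
    The disjunction keeps the hypothesis stable under symmetry. *)
Lemma aeq_atomic S (F G : rpred S) : aeq F G -> atomic F || atomic G -> F = G.
Proof.
elim=> //= [F0 G0 _ IH|F0 G0 H0 a1 IH1 a2 IH2]; first by rewrite orbC => /IH.
case/orP => h.
  have e : F0 = G0 by apply: IH1; rewrite h.
  by rewrite e IH2 // -e h.
have e : G0 = H0 by apply: IH2; rewrite h orbT.
by rewrite -e IH1 // e h orbT.
Qed.

Lemma pclsP S (F G : rpred S) : aeq F G -> pcls F = pcls G.
Proof. by move=> h; apply/eqquotP/asboolP. Qed.

Lemma repr_pcls S (F : rpred S) : aeq (repr (pcls F)) F.
Proof.
by apply/asboolP; apply/(@eqquotP _ _ (pred_of S)); rewrite /pcls reprK.
Qed.

(** * Satisfaction in a Tarski structure *)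

Record structure (S : signature) := Structure {
  dom : Type;
  sfun : forall f : fsym S, ('I_(far f) -> dom) -> dom;
  srel : forall P : psym S, ('I_(par P) -> dom) -> Prop
}.

Definition vupd (D : Type) (v : atom -> D) (a : atom) (d : D) : atom -> D :=
  fun b => if b == a then d else v b.

Lemma vupdE D (v : atom -> D) a d : vupd v a d a = d.
Proof. by rewrite /vupd eqxx. Qed.

Lemma vupdD D (v : atom -> D) a d b : b != a -> vupd v a d b = v b.
Proof. by rewrite /vupd => /negbTE->. Qed.

Lemma vupd_perm D (v : atom -> D) (p : perm) a d :
  vupd v (p a) d \o p = vupd (v \o p) a d.
Proof. by apply: funext => b; rewrite /= /vupd (inj_eq (can_inj (pfunK p))). Qed.

Lemma vupd_id D (v : atom -> D) a : vupd v a (v a) = v.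
Proof. by apply: funext => b; rewrite /vupd; case: eqP => // ->. Qed.

Lemma vupdC D (v : atom -> D) a b d e : a != b ->
  vupd (vupd v a d) b e = vupd (vupd v b e) a d.
Proof.
move=> ab; apply: funext => c; rewrite /vupd; case: (eqVneq c b) => // ->.
by rewrite eq_sym (negbTE ab).
Qed.

Section Satisfaction.
Variables (S : signature) (M : structure S).
Implicit Types (v w : atom -> dom M).

Fixpoint teval v (t : term S) : dom M :=
  match t with
  | TAtm a => v a
  | TApp f ts => sfun (fun i => teval v (ts i))
  end.

Fixpoint rsat v (F : rpred S) : Prop :=
  match F with
  | RBot => False
  | REq r s => teval v r = teval v s
  | RRel P ts => srel (fun i => teval v (ts i))
  | RAnd F1 F2 => rsat v F1 /\ rsat v F2
  | RNot F1 => ~ rsat v F1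
  | RAll a F1 => forall d, rsat (vupd v a d) F1
  end.

Lemma teval_ext v w t : (forall a, a \in tfv t -> v a = w a) -> teval v t = teval w t.
Proof.
elim/term_nested_ind: t => [a|f ts IH] /= h; first by rewrite h // inE.
congr sfun; apply: funext => i; apply: IH => a ai; apply: h.
by apply/mem_bigcup_enum; exists i.
Qed.

Lemma teval_upd_fresh v a d t : a \notin tfv t -> teval (vupd v a d) t = teval v t.
Proof.
move=> at_; apply: teval_ext => b bt; rewrite vupdD //.
by apply: contraNneq at_ => <-.
Qed.

Lemma teval_act v (p : perm) t : teval v (tact p t) = teval (v \o p) t.
Proof.
elim/term_nested_ind: t => [a|f ts IH] //=.
by congr sfun; apply: funext => i; rewrite ffunE.
Qed.

Lemma teval_subst v th t :
  teval v (tsubst th t) = teval (fun a => teval v (th a)) t.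
Proof.
elim/term_nested_ind: t => [a|f ts IH] //=.
by congr sfun; apply: funext => i; rewrite ffunE.
Qed.

Lemma teval_subst1 v a r t :
  teval v (tsubst (upd TAtm a r) t) = teval (vupd v a (teval v r)) t.
Proof.
rewrite teval_subst; congr (teval _ t); apply: funext => b.
by rewrite /upd /vupd; case: eqP.
Qed.

Lemma rsat_ext v w F : (forall a, a \in rfv F -> v a = w a) -> rsat v F = rsat w F.
Proof.
elim: F v w => [|r s|P ts|F IF G IG|F IF|b F IF] v w //= h.
- by rewrite !(@teval_ext v w) // => a ai; apply: h; rewrite inE ai ?orbT.
- congr srel; apply: funext => i; apply: teval_ext => a ai; apply: h.
  by apply/mem_bigcup_enum; exists i.
- by rewrite (IF v w) ?(IG v w) // => a ai; apply: h; rewrite inE ai ?orbT.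
- by rewrite (IF v w).
- apply: eq_forall => d; apply: IF => a ai; rewrite /vupd; case: eqP => // ab.
  by apply: h; rewrite !inE ai andbT; apply/eqP.
Qed.

Lemma rsat_act v (p : perm) F : rsat v (ract p F) = rsat (v \o p) F.
Proof.
elim: F v => [|r s|P ts|F IF G IG|F IF|b F IF] v //=.
- by rewrite !teval_act.
- by congr srel; apply: funext => i; rewrite ffunE teval_act.
- by rewrite IF IG.
- by rewrite IF.
- by apply: eq_forall => d; rewrite IF vupd_perm.
Qed.

(** The swap makes [a] read the value stored at [b], and every other free atom differs from both.
    This settles the renaming of bound atoms and, later, eigenvariables. *)
Lemma rsat_swap v a b F d : b \notin rfv F ->
  rsat (vupd v b d) (ract (swap b a) F) = rsat (vupd v a d) F.
Proof.
move=> bF; rewrite rsat_act; apply: rsat_ext => c cF.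
have cb : c != b by apply: contraNneq bF => <-.
have [->|ca] := eqVneq c a; first by rewrite [LHS]/comp swapR !vupdE.
by rewrite [LHS]/comp swapD // !vupdD.
Qed.

Lemma rsat_aeq F G : aeq F G -> forall v, rsat v F = rsat v G.
Proof.
elim=> //= [F0 G0 H0 _ h1 _ h2|F0 F1 G0 G1 _ h1 _ h2|F0 F1 _ h|a F0 F1 _ h|a b F0 bF] v.
- by rewrite h1.
- by rewrite h1 h2.
- by rewrite h.
- by apply: eq_forall => d.
- by apply: eq_forall => d; rewrite rsat_swap.
Qed.

Lemma rsat_subst v th F :
  rsat v (rsubst th F) = rsat (fun a => teval v (th a)) F.
Proof.
elim: F v th => [|r s|P ts|F IF G IG|F IF|b F IF] v th //=.
- by rewrite !teval_subst.
- by congr srel; apply: funext => i; rewrite ffunE teval_subst.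
- by rewrite IF IG.
- by rewrite IF.
- set c := new_atom _; apply: eq_forall => d; rewrite IF; apply: rsat_ext => a aF.
  rewrite /upd /vupd; case: eqP => ab /=; first by rewrite eqxx.
  (* [c] was chosen outside the terms substituted for the free atoms of the quantified predicate, so
     their values ignore the update at [c]. *)
  apply: teval_upd_fresh.
  apply: contraNN (new_atomP (\bigcup_(x <- rfv F `\ b) tfv (th x))) => ca.
  by apply/bigfcupP; exists a => //; rewrite !inE aF !andbT; apply/eqP.
Qed.

Lemma rsat_subst1 v a r F :
  rsat v (rsubst (upd TAtm a r) F) = rsat (vupd v a (teval v r)) F.
Proof.
rewrite rsat_subst; congr (rsat _ F); apply: funext => b.
by rewrite /upd /vupd; case: eqP.
Qed.

End Satisfaction.

(** * The termlike algebra of terms *)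

(** Evaluation in this structure is parallel substitution, with renaming as a special case, so the
    substitution laws of terms reduce to comparing valuations. *)
Definition term_structure S : structure S :=
  @Structure S (term S) (fun f ts => TApp [ffun i => ts i]) (fun _ _ => False).

Lemma tsubst_teval S th (t : term S) : tsubst th t = teval (M := term_structure S) th t.
Proof.
elim/term_nested_ind: t => [a|f ts IH] //=.
by congr TApp; apply/ffunP => i; rewrite !ffunE.
Qed.

Lemma tact_teval S (p : perm) (t : term S) :
  tact p t = teval (M := term_structure S) (TAtm \o p) t.
Proof.
elim/term_nested_ind: t => [a|f ts IH] //=.
by congr TApp; apply/ffunP => i; rewrite !ffunE.
Qed.

Lemma tact1 S (t : term S) : tact perm1 t = t.
Proof. exact: tact_id. Qed.

Lemma tact_fin S (t : term S) : exists A, supports (@tact S) A t.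
Proof. by exists (tfv t) => p; apply: tact_id. Qed.

Definition term_nom S : nomset := NomSet (@tact1 S) (@tactM S) (@tact_fin S).

(** The free atoms form a support. No support [A] omits a free atom [a]: swapping [a] with some [b]
    outside [A] and the term would fix the term, yet remove [a] from its free atoms. *)
Lemma fresh_term S a (t : term_nom S) : fresh a t <-> a \notin tfv t.
Proof.
split=> [fr|at_ /(_ (tfv t))]; last first.
  by move=> h; move: at_; rewrite h // => p; apply: tact_id.
apply/negP => at_; apply: fr => A supA; apply/negPn/negP => aA.
have := new_atomP (A `|` tfv t); set b := new_atom _.
rewrite inE negb_or => /andP[bA bt].
have /(congr1 (@tfv S)) /fsetP /(_ a) : tact (swap a b) t = t.
  apply: supA => c cA; rewrite swapD //.
    by apply: contraNneq aA => <-.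
  by apply: contraNneq bA => <-.
by rewrite tfv_act [pinv _ _]swapL at_ (negbTE bt).
Qed.

Definition term_sub S (t : term_nom S) (a : atom) (u : term_nom S) : term_nom S :=
  tsubst (upd TAtm a u) t.

Lemma term_sub_laws S : sigma_laws (@term_sub S) (@term_sub S) (@TAtm S).
Proof.
split=> [p x a u|a x|a x u /fresh_term ax|a b x u ab /fresh_term bx|
  a b x u v ab /fresh_term av]; rewrite /term_sub /=.
- rewrite [LHS]tact_teval teval_subst [RHS]tsubst_teval teval_act.
  apply: (@teval_ext S (term_structure S)) => b _.
  by rewrite /= /upd (inj_eq (can_inj (pfunK p))); case: eqP => //= _; rewrite tact_teval.
- by apply: tsubst_id => b _; rewrite /upd; case: eqP => // ->.
- exact: tsubst_fresh.
- rewrite !tsubst_teval teval_act; apply: (@teval_ext S (term_structure S)) => c cx.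
  have cb : c != b by apply: contraNneq bx => <-.
  have [->|ca] := eqVneq c a; rewrite [RHS]/comp; first by rewrite swapR /upd !eqxx.
  by rewrite swapD // /upd (negbTE ca) (negbTE cb).
- rewrite [LHS]tsubst_teval [RHS]tsubst_teval !teval_subst.
  apply: (@teval_ext S (term_structure S)) => c _; rewrite -!tsubst_teval /upd.
  have [->|ca] := eqVneq c a.
    by rewrite (_ : (a == b) = false) /=; [rewrite eqxx|apply/eqP].
  have [->|cb] := eqVneq c b; first by rewrite /= eqxx tsubst_fresh.
  by rewrite /= (negbTE ca) (negbTE cb).
Qed.

Lemma term_sub_atm S a (x : term_nom S) : term_sub (TAtm a) a x = x.
Proof. by rewrite /term_sub /= /upd eqxx. Qed.

Lemma TAtm_inj S : injective (@TAtm S).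
Proof. by move=> a b []. Qed.

Definition term_tl S : termlike :=
  @Termlike (term_nom S) TAtm (@term_sub S) (fun _ _ => erefl) (@TAtm_inj S)
    (@term_sub_atm S) (@term_sub_laws S).

(** * Simultaneous substitution as valuation update *)

Lemma fresh_tupleP n (avoid : set atom) (A : {fset atom}) :
  (forall c, avoid c -> c \in A) ->
  uniq (fresh_tuple n avoid) /\ forall c, c \in fresh_tuple n avoid -> ~ avoid c.
Proof.
move=> hA; rewrite /fresh_tuple; case: xgetP => [t _ //|/(_ (iota_tuple n (new_atom A)))].
case; split; first exact: iota_uniq.
move=> c; rewrite mem_iota => /andP[le_c _] /hA /ltn_new_atom.
by rewrite ltnNge le_c.
Qed.

Lemma supp_finite (X : nomset) (x : X) : exists A : {fset atom}, forall c, supp x c -> c \in A.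
Proof. by case: (act_fin x) => A hA; exists A => c; apply. Qed.

Lemma supp_tuple_finite (X : nomset) n (us : n.-tuple X) :
  exists A : {fset atom}, forall c, (exists i, supp (tnth us i) c) -> c \in A.
Proof.
have [g hg] := choice (fun i => supp_finite (tnth us i)).
exists (\bigcup_(i <- enum 'I_n) g i) => c [i ci].
by apply/mem_bigcup_enum; exists i; apply: hg.
Qed.

Lemma fresh_argsP (X : nomset) n (us : n.-tuple X) : uniq (fresh_args us).
Proof. by have [A hA] := supp_tuple_finite us; case: (fresh_tupleP n hA). Qed.

(** The head of the list is the outermost update, matching how evaluation unfolds substitutions
    performed from the head onwards. *)
Definition vupds (D : Type) (v : atom -> D) (l : seq (atom * D)) : atom -> D :=
  foldr (fun cd w => vupd w cd.1 cd.2) v l.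

Lemma vupds_notin D (v : atom -> D) l b : b \notin unzip1 l -> vupds v l b = v b.
Proof.
by elim: l => //= -[c d] l IH /=; rewrite inE negb_or => /andP[bc /IH]; rewrite vupdD.
Qed.

Lemma vupds_zip D (v : atom -> D) n (s : n.-tuple atom) (ds : n.-tuple D) i :
  uniq s -> vupds v (zip s ds) (tnth s i) = tnth ds i.
Proof.
rewrite (tnth_nth (tnth s i)) [in RHS](tnth_nth (tnth ds i)).
move: (tnth ds i) (tnth s i) => d0 a0.
case: i => i /=; case: ds s => [ds /= /eqP <-] [s /= /eqP].
elim: s ds i => [|a s IH] [|d ds] [|i] //= [ss] ilt /andP[as_ us]; first by rewrite vupdE.
rewrite vupdD ?IH //; apply: contraNneq as_ => <-.
by rewrite mem_nth // ss.
Qed.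

Lemma vupds_zip_map D U (g : U -> D) (v : atom -> D) n (s : n.-tuple atom)
    (us : n.-tuple U) i :
  uniq s -> vupds v (zip s [seq g u | u <- us]) (tnth s i) = g (tnth us i).
Proof.
by move=> Us; rewrite -(tnth_map g us i); apply: (@vupds_zip _ _ _ _ (map_tuple g us)).
Qed.

Definition swaps (l : seq (atom * atom)) : atom -> atom :=
  foldr (fun ca h => swap ca.1 ca.2 \o h) id l.

Lemma swaps_cons c a l b : swaps ((c, a) :: l) b = swap c a (swaps l b).
Proof. by []. Qed.

Lemma swaps_notin l b : b \notin unzip1 l -> b \notin unzip2 l -> swaps l b = b.
Proof.
elim: l => [|[c a] l IH] //; rewrite [unzip1 _]/= [unzip2 _]/= !inE !negb_or.
by move=> /andP[bc b1] /andP[ba b2]; rewrite swaps_cons IH // swapD.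
Qed.

Lemma swaps_range l b : uniq (unzip1 l) -> b \notin unzip1 l ->
  swaps l b = b \/ swaps l b \in unzip1 l.
Proof.
elim: l => [|[c a] l IH]; first by left.
rewrite [unzip1 _]/= inE negb_or => /andP[cl ul] /andP[bc bl].
rewrite swaps_cons.
have sc : swaps l b != c.
  by case: (IH ul bl) => [->//|h]; apply: contraNneq cl => <-.
have [->|sa] := eqVneq (swaps l b) a; first by right; rewrite swapR mem_head.
rewrite swapD //; case: (IH ul bl) => [->|h]; [by left|right].
by rewrite inE h orbT.
Qed.

(** An atom of [s] moves to its partner in [cs] and reads the value stored there. By [swaps_range]
    the outer swaps do not disturb the images produced by the inner ones. *)
Lemma vupds_swaps D (v : atom -> D) cs s ds b :
  size cs = size s -> size ds = size s -> uniq cs -> uniq s ->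
  (forall c, c \in cs -> c \notin s) -> b \notin cs ->
  vupds v (zip cs ds) (swaps (zip cs s) b) = vupds v (zip s ds) b.
Proof.
elim: cs s ds => [|c cs IH] [|a s] [|d ds] //= [ss] [sd] /andP[ccs ucs] /andP[as_ us] dis.
rewrite inE negb_or => /andP[bc bcs].
have dis' x : x \in cs -> x \notin s.
  by move=> xcs; have := dis x; rewrite !inE xcs orbT negb_or => /(_ isT) /andP[].
have acs : a \notin cs.
  by apply/negP => acs; have := dis a; rewrite !inE acs eqxx orbT => /(_ isT).
rewrite -[swap_fun _ _ _]/(swap c a _).
have u1 : unzip1 (zip cs s) = cs by rewrite unzip1_zip // ss.
have u2 : unzip2 (zip cs s) = s by rewrite unzip2_zip // ss.
have [->|ba] := eqVneq b a.
  by rewrite swaps_notin ?u1 ?u2 // swapR !vupdE.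
have := @swaps_range (zip cs s) b; rewrite u1 => /(_ ucs bcs) rg.
have sa : swaps (zip cs s) b != a.
  by case: rg => [->//|h]; apply: contraNneq acs => <-.
have sc : swaps (zip cs s) b != c.
  by case: rg => [->//|h]; apply: contraNneq ccs => <-.
by rewrite swapD // !vupdD // IH.
Qed.

Section Evaluation.
Variables (S : signature) (M : structure S) (X : nomset).
Variables (sub : X -> atom -> term_nom S -> X) (Y : Type).
Variable ev : X -> (atom -> dom M) -> Y.
Hypothesis ev_act : forall p x v, ev (act p x) v = ev x (v \o p).
Hypothesis ev_sub : forall x a u v, ev (sub x a u) v = ev x (vupd v a (teval v u)).
Hypothesis ev_fresh : forall x a v d, fresh a x -> ev x (vupd v a d) = ev x v.

Lemma ev_agree x (cs : seq atom) v w : (forall c, c \in cs -> fresh c x) ->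
  (forall b, b \notin cs -> w b = v b) -> ev x w = ev x v.
Proof.
elim: cs v => [|c cs IH] v fr eqvw; first by congr (ev x); apply: funext => b; apply: eqvw.
have fc : fresh c x by apply: fr; rewrite mem_head.
rewrite -(ev_fresh v (w c) fc); apply: IH => [b bcs|b bcs].
  by apply: fr; rewrite inE bcs orbT.
rewrite /vupd; case: eqP => [->//|/eqP bc]; apply: eqvw.
by rewrite inE negb_or bc.
Qed.

(** The abstract [ev] covers both uses: values of terms in [M] and truth of predicates on
    valuations. *)
Lemma ev_simsub n x (s : n.-tuple atom) (us : n.-tuple (term_nom S)) v : uniq s ->
  ev (simsub sub x s us) v = ev x (vupds v (zip s [seq teval v u | u <- us])).
Proof.
move=> Us; rewrite /simsub; set cs := fresh_tuple _ _.
have [Ucs csP] : uniq cs /\ forall c, c \in cs ->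
    ~ [\/ supp x c, c \in s | exists i, supp (tnth us i) c].
  have [A hA] := supp_finite x; have [B hB] := supp_tuple_finite us.
  apply: (@fresh_tupleP _ _ (A `|` seq_fset tt s `|` B)) => c.
  rewrite !inE seq_fsetE => -[/hA->|->|/hB->]; by rewrite ?orbT.
have csx c : c \in cs -> fresh c x by move=> /csP h sc; apply: h; constructor 1.
have css c : c \in cs -> c \notin s.
  by move=> /csP h; apply/negP => sc; apply: h; constructor 2.
have csu c u : c \in cs -> u \in (us : seq (term S)) -> c \notin tfv u.
  move=> /csP h /tnthP[i ->]; apply/fresh_term => sc; apply: h.
  by constructor 3; exists i.
have szc : size cs = size s by rewrite !size_tuple.
have szu : size us = size s by rewrite !size_tuple.
move: cs Ucs csx css csu szc {csP} => /= cs Ucs csx css csu szc.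
(* No atom of [cs] is free in any of [us], so the updates made for the remaining pairs leave the
   value of each [u] unchanged. *)
have evl y (cs' : seq atom) (us' : seq (term S)) : size cs' = size us' ->
    {subset cs' <= cs} -> {subset us' <= (us : seq (term S))} ->
    ev (foldl (fun y cu => sub y cu.1 cu.2) y (zip cs' us')) v =
    ev y (vupds v (zip cs' [seq teval v u | u <- us'])).
  elim: cs' us' y => [|c cs' IH] [|u us'] y //= [ss] scs sus.
  rewrite IH //; last 2 first.
  - by move=> z zc; apply: scs; rewrite inE zc orbT.
  - by move=> z zc; apply: sus; rewrite inE zc orbT.
  rewrite ev_sub; congr (ev y (vupd _ _ _)); apply: teval_ext => b bu.
  rewrite vupds_notin // unzip1_zip ?size_map ?ss //.
  apply/negP => bcs; have := csu b u; rewrite bu scs ?inE ?bcs ?orbT //.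
  by rewrite sus ?mem_head // => /(_ isT isT).
rewrite evl ?szc ?szu //.
have evr l w : ev (foldr (fun ca y => act (swap ca.1 ca.2) y) x l) w = ev x (w \o swaps l).
  by elim: l w => //= -[c a] l IH w; rewrite ev_act IH.
rewrite evr; apply: (@ev_agree x cs) => // b bcs.
by rewrite /comp vupds_swaps // size_map.
Qed.

End Evaluation.

(** * The algebra of finitely determined predicates on valuations *)

Section PredicateAlgebra.
Variables (S : signature) (M : structure S).
Implicit Types (v w : atom -> dom M).

Definition finite_dep (x : (atom -> dom M) -> Prop) :=
  exists D : {fset atom}, forall v w, (forall a, a \in D -> v a = w a) -> x v = x w.

Definition vpred := {x : (atom -> dom M) -> Prop | finite_dep x}.

Lemma vpred_eq (x y : vpred) : (forall v, sval x v = sval y v) -> x = y.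
Proof.
case: x y => [x hx] [y hy] /= /funext xy; case: y / xy hy => hy.
by congr exist; apply: Prop_irrelevance.
Qed.

Lemma vact_dep (p : perm) (x : vpred) : finite_dep (fun v => sval x (v \o p)).
Proof.
case: x => x [D hD] /=; exists [fset p a | a in D] => v w vw.
by apply: hD => a aD /=; apply: vw; apply: in_imfset.
Qed.

Definition vact (p : perm) (x : vpred) : vpred := exist _ _ (vact_dep p x).

Lemma vact1 x : vact perm1 x = x.
Proof. by apply: vpred_eq. Qed.

Lemma vactM p q x : vact (permM p q) x = vact p (vact q x).
Proof. by apply: vpred_eq. Qed.

Lemma supports_dep (x : vpred) (D : {fset atom}) :
  (forall v w, (forall a, a \in D -> v a = w a) -> sval x v = sval x w) ->
  supports vact D x.
Proof. by move=> hD p pD; apply: vpred_eq => v; apply: hD => a /pD /= ->. Qed.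

Lemma vact_fin x : exists A, supports vact A x.
Proof. by case: (svalP x) => D hD; exists D; apply: supports_dep. Qed.

Definition vnom : nomset := NomSet vact1 vactM vact_fin.

(** Independence of [a] lets [a] be dropped from a determining set, which is a support. Conversely,
    a support without [a] makes [x] invariant under swapping [a] with some [b] on which [x] does not
    depend. *)
Lemma fresh_vpred a (x : vnom) :
  fresh a x <-> forall v d, sval x (vupd v a d) = sval x v.
Proof.
have [D hD] := svalP x; split=> [|ind]; last first.
  move/(_ (D `\ a)); rewrite !inE eqxx /= => h; suff /h : supports vact (D `\ a) x by [].
  apply: supports_dep => v w vw; rewrite -(ind v (w a)); apply: hD => b bD.
  by rewrite /vupd; case: eqP => [->//|/eqP ba]; apply: vw; rewrite !inE ba.
move=> /existsNP[A /not_implyP[supA /negP aA]] v d.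
have := new_atomP (A `|` D `|` [fset a]); set b := new_atom _.
rewrite !inE !negb_or => /andP[/andP[bA bD] ba].
have xab : vact (swap a b) x = x.
  apply: supA => c cA; rewrite swapD //.
    by apply: contraNneq aA => <-.
  by apply: contraNneq bA => <-.
have indb u e : sval x (vupd u b e) = sval x u.
  by apply: hD => c cD; rewrite vupdD //; apply: contraNneq bD => <-.
(* Store [e] at the irrelevant atom [b]; the swap brings it to [a] and sends the old value of [a] to
   [b], where it is again irrelevant. *)
have step u e : sval x u = sval x (vupd u a e).
  rewrite -(indb u e) -{1}xab /= -(indb (vupd u a e) (u a)); congr (sval x _).
  apply: funext => c; rewrite /comp -[swap_fun _ _ _]/(swap a b c).
  have [->|ca] := eqVneq c a; first by rewrite swapL vupdE vupdD ?vupdE // eq_sym.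
  have [->|cb] := eqVneq c b; first by rewrite swapR vupdE vupdD // eq_sym.
  by rewrite swapD // !vupdD.
by rewrite -step.
Qed.

Lemma fresh_for_agree (A : {fset atom}) (x : vnom) v w : fresh_for A x ->
  (forall b, b \notin A -> w b = v b) -> sval x w = sval x v.
Proof.
move=> fr; apply: (@ev_agree S M vnom _ (fun x v => sval x v)) => //.
by move=> y a u d /fresh_vpred.
Qed.

(** * Substitution on predicates *)

Lemma vsub_dep (x : vpred) (a : atom) (u : term S) :
  finite_dep (fun v => sval x (vupd v a (teval v u))).
Proof.
case: x => x [D hD] /=; exists (D `|` tfv u) => v w vw; apply: hD => b bD.
rewrite /vupd; case: eqP => _; last by apply: vw; rewrite inE bD.
by apply: teval_ext => c cu; apply: vw; rewrite inE cu orbT.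
Qed.

Definition vsub (x : vnom) (a : atom) (u : term_nom S) : vnom :=
  exist _ _ (vsub_dep x a u).

Lemma vsub_laws : sigma_laws vsub (@term_sub S) (@TAtm S).
Proof.
split=> [p x a u|a x|a x u /fresh_vpred ax|a b x u ab /fresh_vpred bx|
  a b x u t /eqP ab /fresh_term at_]; apply: vpred_eq => v /=.
- by rewrite teval_act vupd_perm.
- by rewrite vupd_id.
- exact: ax.
(* Since [x] ignores [b], the valuation may be set there to [v a], which is what the swap puts at
   [b]. *)
- rewrite -(bx _ (v a)); congr (sval x _); apply: funext => c.
  rewrite /comp -[swap_fun _ _ _]/(swap b a c).
  have [->|cb] := eqVneq c b.
    by rewrite swapL vupdE vupdD //; apply/eqP.
  have [->|ca] := eqVneq c a; first by rewrite swapR vupdE vupdD ?vupdE //; apply/eqP.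
  by rewrite swapD // !vupdD.
- rewrite /term_sub teval_subst1 [teval (vupd v a _) t]teval_upd_fresh //.
  by rewrite vupdC // eq_sym.
Qed.

Definition vsigma : sigma_alg (term_tl S) := @SigmaAlg (term_tl S) vnom vsub vsub_laws.

(** * Limits, colimits and complements *)

Definition agree_off (A : {fset atom}) v w := forall b, b \notin A -> w b = v b.

Lemma seq_dep (X : seq vpred) : exists D : {fset atom}, forall x, List.In x X ->
  forall v w, (forall a, a \in D -> v a = w a) -> sval x v = sval x w.
Proof.
elim: X => [|x X [D hD]]; first by exists fset0.
have [E hE] := svalP x; exists (D `|` E) => y [<-|/hD hy] v w vw.
  by apply: hE => a aE; apply: vw; rewrite inE aE orbT.
by apply: hy => a aD; apply: vw; rewrite inE aD.
Qed.

Lemma agree_off_dep (A D : {fset atom}) v v' w' :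
  (forall a, a \in D -> v a = v' a) -> agree_off A v' w' ->
  exists2 w, agree_off A v w & forall a, a \in D -> w a = w' a.
Proof.
move=> vv' vw'; exists (fun b => if b \in A then w' b else v b) => [b|a aD].
  by move/negbTE->.
by case: ifPn => // aA; rewrite vv' // vw'.
Qed.

Lemma vlim_dep (A : {fset atom}) (X : seq vpred) :
  finite_dep (fun v => forall w, agree_off A v w -> forall x, List.In x X -> sval x w).
Proof.
have [D hD] := seq_dep X; exists D.
suff sub v v' : (forall a, a \in D -> v a = v' a) ->
    (forall w, agree_off A v w -> forall x, List.In x X -> sval x w) ->
    forall w, agree_off A v' w -> forall x, List.In x X -> sval x w.
  by move=> v v' vv'; apply: propext; split; apply: sub => // a /vv'.
move=> vv' h w' vw' x xX; have [w vw ww'] := agree_off_dep vv' vw'.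
by rewrite -(hD x xX _ _ ww'); apply: h.
Qed.

(** Universal quantification over the values of the atoms of [A]: a meet for empty [A], the
    quantifier for a single atom. [vcolim] is its existential dual. *)
Definition vlim A (X : seq vsigma) : vsigma := exist _ _ (vlim_dep A X).

Lemma vcolim_dep (A : {fset atom}) (X : seq vpred) :
  finite_dep (fun v => exists2 w, agree_off A v w & exists2 x, List.In x X & sval x w).
Proof.
have [D hD] := seq_dep X; exists D.
suff sub v v' : (forall a, a \in D -> v a = v' a) ->
    (exists2 w, agree_off A v w & exists2 x, List.In x X & sval x w) ->
    exists2 w, agree_off A v' w & exists2 x, List.In x X & sval x w.
  by move=> v v' vv'; apply: propext; split; apply: sub => // a /vv'.
move=> vv' [w' vw' [x xX xw']].
have [|w vw ww'] := @agree_off_dep A D v' v w' _ vw'; first by move=> a /vv'.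
by exists w => //; exists x => //; rewrite (hD x xX _ _ ww').
Qed.

Definition vcolim A (X : seq vsigma) : vsigma := exist _ _ (vcolim_dep A X).

Lemma vcompl_dep (x : vpred) : finite_dep (fun v => ~ sval x v).
Proof. by case: x => x [D hD] /=; exists D => v w /hD->. Qed.

Definition vcompl (x : vsigma) : vsigma := exist _ _ (vcompl_dep x).

Definition vle (x y : vsigma) := forall v, sval x v -> sval y v.

Lemma vle_equiv p x y : vle x y -> vle (act p x) (act p y).
Proof. by move=> xy v; apply: xy. Qed.

Lemma vle_refl x : vle x x. Proof. by []. Qed.

Lemma vle_anti x y : vle x y -> vle y x -> x = y.
Proof.
by move=> xy yx; apply: vpred_eq => v; apply: propext; split; [apply: xy|apply: yx].
Qed.

Lemma vle_trans x y z : vle x y -> vle y z -> vle x z.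
Proof. by move=> xy yz v /xy /yz. Qed.

Lemma agree_off_upd (A : {fset atom}) a v d w :
  a \in A -> agree_off A (vupd v a d) w <-> agree_off A v w.
Proof.
by move=> aA; split=> h b bA; rewrite h // vupdD //; apply: contraNneq bA => ->.
Qed.

Lemma vlimP A X : is_limit vle A X (vlim A X).
Proof.
split=> [a aA|y yX v h|z zA h v zv w vw y yX].
- apply/fresh_vpred => v d /=; apply: eq_forall => w.
  by rewrite (propext (agree_off_upd _ _ _ aA)).
- by apply: h.
- by apply: h => //; rewrite (fresh_for_agree zA vw).
Qed.

Lemma vcolimP A X : is_limit (fun x y => vle y x) A X (vcolim A X).
Proof.
split=> [a aA|y yX v yv|z zA h v [w vw [y yX yw]]].
- apply/fresh_vpred => v d /=; apply: propext; split=> -[w vw h]; exists w => //.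
    by apply/(agree_off_upd v d w aA).
  by apply/(agree_off_upd v d w aA).
- by exists v => //; exists y.
- by rewrite -(fresh_for_agree zA vw); apply: h yw.
Qed.

Lemma vlim0E X v : sval (vlim fset0 X) v = forall x, List.In x X -> sval x v.
Proof.
apply: propext; split=> /= h; first exact: h.
by move=> w vw; rewrite (_ : w = v) //; apply: funext => b; apply: vw.
Qed.

Lemma vcolim0E X v : sval (vcolim fset0 X) v = exists2 x, List.In x X & sval x v.
Proof.
apply: propext; split=> /= [[w vw]|]; last by exists v.
by rewrite (_ : w = v) //; apply: funext => b; apply: vw.
Qed.

Lemma vtopE v : sval (vlim fset0 [::]) v = True.
Proof. by rewrite vlim0E; apply: propext; split. Qed.

Lemma vbotE v : sval (vcolim fset0 [::]) v = False.
Proof. by rewrite vcolim0E; apply: propext; split=> // -[]. Qed.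

Lemma vmeetE x y v : sval (vlim fset0 [:: x; y]) v = (sval x v /\ sval y v).
Proof.
rewrite vlim0E; apply: propext; split=> [h|[xv yv] z /= [<-|[<-|[]]]] //.
by split; apply: h => /=; [left|right; left].
Qed.

Lemma vjoinE x y v : sval (vcolim fset0 [:: x; y]) v = (sval x v \/ sval y v).
Proof.
rewrite vcolim0E; apply: propext; split=> [[z /= [->|[->|[]]] zv]|]; [by left|by right|].
by case=> h; [exists x|exists y] => //=; [left|right; left].
Qed.

Lemma vallE a x v : sval (vlim [fset a] [:: x]) v = forall d, sval x (vupd v a d).
Proof.
apply: propext; split=> /= [h d|h w vw y [<-|[]]].
  by apply: h; [move=> b; rewrite inE => ba; rewrite vupdD|left].
rewrite (_ : w = vupd v a (w a)) //; apply: funext => b; rewrite /vupd.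
by case: eqP => [->//|/eqP ba]; apply: vw; rewrite inE.
Qed.

Lemma vjoin_meet (x y z : vsigma) :
  vcolim fset0 [:: x; vlim fset0 [:: y; z]]
  = vlim fset0 [:: vcolim fset0 [:: x; y]; vcolim fset0 [:: x; z]].
Proof.
apply: vpred_eq => v; rewrite vmeetE !vjoinE vmeetE; apply: propext; tauto.
Qed.

Lemma vjoin_lim a (x y : vsigma) : fresh a x ->
  vcolim fset0 [:: x; vlim [fset a] [:: y]] = vlim [fset a] [:: vcolim fset0 [:: x; y]].
Proof.
move=> /fresh_vpred ax; apply: vpred_eq => v; rewrite vjoinE !vallE.
apply: propext; split=> [h d|h].
  by rewrite vjoinE ax; case: h => [|/(_ d)]; [left|right].
(* A disjunct independent of [a] leaves the scope of the quantifier by a classical case split. *)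
have [xv|nxv] := EM (sval x v); [by left|right] => d.
by have := h d; rewrite vjoinE ax => -[].
Qed.

Lemma vmeet_compl x : vlim fset0 [:: x; vcompl x] = vcolim fset0 [::].
Proof. by apply: vpred_eq => v; rewrite vmeetE vbotE; apply: propext; split=> // -[]. Qed.

Lemma vjoin_compl x : vcolim fset0 [:: x; vcompl x] = vlim fset0 [::].
Proof.
by apply: vpred_eq => v; rewrite vjoinE vtopE; apply: propext; split=> // _; apply: EM.
Qed.

(** The value of [u] ignores the atoms of [A], and [a] is outside [A], so varying [A] commutes with
    the update. Both commutation laws below rest on this. *)
Lemma agree_off_sub A a (u : term_nom S) v w : a \notin A -> fresh_for A u ->
  agree_off A (vupd v a (teval v u)) w <->
  exists2 w', agree_off A v w' & w = vupd w' a (teval w' u).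
Proof.
move=> aA uA.
have evu w' : agree_off A v w' -> teval w' u = teval v u.
  move=> vw'; apply: teval_ext => b bu; apply: vw'; apply/negP => /uA /fresh_term.
  by rewrite bu.
split=> [vw|[w' vw' ->] b bA]; last first.
  by rewrite evu // /vupd; case: eqP => // _; apply: vw'.
have vw' : agree_off A v (vupd w a (v a)).
  move=> b bA; rewrite /vupd; case: eqP => [->//|/eqP ba].
  by rewrite vw // vupdD.
exists (vupd w a (v a)) => //; rewrite evu //; apply: funext => b.
rewrite /vupd; case: eqP => // ->.
by rewrite vw // vupdE.
Qed.

Lemma vsub_lim A (X : seq vsigma) a (u : term_tl S) : a \notin A -> fresh_for A u ->
  ssub (vlim A X) a u = vlim A [seq ssub x a u | x <- X].
Proof.
move=> aA uA; apply: vpred_eq => v /=; apply: propext; split=> h w vw x.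
  case/List.in_map_iff => y [<- yX] /=; apply: h yX.
  by apply/(agree_off_sub _ _ aA uA); exists w.
move=> xX; have /(agree_off_sub _ _ aA uA)[w' vw' ->] := vw.
by apply: (h w' vw' (vsub x a u)); apply/List.in_map_iff; exists x.
Qed.

Lemma vsub_colim A (X : seq vsigma) a (u : term_tl S) : a \notin A -> fresh_for A u ->
  ssub (vcolim A X) a u = vcolim A [seq ssub x a u | x <- X].
Proof.
move=> aA uA; apply: vpred_eq => v /=; apply: propext; split.
  move=> [w /(agree_off_sub _ _ aA uA)[w' vw' ->] [x xX xw]]; exists w' => //.
  by exists (vsub x a u) => //; apply/List.in_map_iff; exists x.
move=> [w vw [_ /List.in_map_iff[x [<- xX]] xw]].
exists (vupd w a (teval w u)); last by exists x.
by apply/(agree_off_sub _ _ aA uA); exists w.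
Qed.

Lemma vsub_compl (x : vsigma) a (u : term_tl S) :
  ssub (vcompl x) a u = vcompl (ssub x a u).
Proof. exact: vpred_eq. Qed.

(** * The equality element *)

Lemma veq_dep : finite_dep (fun v => v 0 = v 1).
Proof. by exists [fset 0; 1] => v w vw; rewrite !vw // !inE eqxx ?orbT. Qed.

Definition veq : vsigma := exist _ _ veq_dep.

Lemma veq_supp c : supp (veq : vsigma) c -> c = 0 \/ c = 1.
Proof.
move/(_ [fset 0; 1]); rewrite !inE => h; suff /orP[/eqP|/eqP] : (c == 0) || (c == 1) by tauto.
apply: h; apply: supports_dep => v w vw; rewrite /= !vw // !inE eqxx ?orbT //.
Qed.

Lemma vsimsubE n (x : vsigma) (s : n.-tuple atom) (us : n.-tuple (term_tl S)) v :
  uniq s -> sval (simsub (@ssub _ vsigma) x s us) v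
  = sval x (vupds v (zip s [seq teval v u | u <- us])).
Proof.
apply: (@ev_simsub S M vnom _ _ (fun x v => sval x v)) => //.
by move=> y a u d /fresh_vpred.
Qed.

Lemma veqE (u t : term_tl S) v :
  sval (simsub (@ssub _ vsigma) veq [tuple 0; 1] [tuple u; t]) v
  = (teval v u = teval v t).
Proof. by rewrite vsimsubE. Qed.

Lemma veq_refl (u : term_tl S) :
  simsub (@ssub _ vsigma) veq [tuple 0; 1] [tuple u; u] = vlim fset0 [::].
Proof. by apply: vpred_eq => v; rewrite veqE vtopE; apply: propext. Qed.

Lemma veq_subst (u t : term_tl S) (z : vsigma) :
  let e := simsub (@ssub _ vsigma) veq [tuple 0; 1] [tuple u; t] in
  vlim fset0 [:: e; ssub z 0 u] = vlim fset0 [:: e; ssub z 0 t].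
Proof.
apply: vpred_eq => v; rewrite !vmeetE veqE /=; apply: propext.
by split=> -[e]; rewrite e.
Qed.

Definition vfoleq : foleq (term_tl S) :=
  @FOLeq (term_tl S) vsigma vle vle_equiv vle_refl vle_anti vle_trans
    vlim vlimP vcolim vcolimP vjoin_meet vjoin_lim vcompl vmeet_compl vjoin_compl
    vsub_lim vsub_colim vsub_compl 0 1 (@O_S 0) veq veq_supp veq_refl veq_subst.

(** * The interpretation of the signature *)

Definition vfint (f : fsym S) (s : (far f).-tuple atom) : term_tl S :=
  TApp [ffun i => TAtm (tnth s i)].

Lemma vpint_dep (P : psym S) (s : (par P).-tuple atom) :
  finite_dep (fun v => srel (fun i => v (tnth s i))).
Proof.
exists (seq_fset tt s) => v w vw; congr srel; apply: funext => i.
by apply: vw; rewrite seq_fsetE mem_tnth.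
Qed.

Definition vpint (P : psym S) (s : (par P).-tuple atom) : vfoleq :=
  exist _ _ (vpint_dep s).

Lemma vfint_equiv (p : perm) f (s : (far f).-tuple atom) : uniq s ->
  act p (vfint s) = vfint (map_tuple p s).
Proof.
by move=> _; congr TApp; apply/ffunP => i; rewrite !ffunE /= tnth_map.
Qed.

Lemma vpint_equiv (p : perm) P (s : (par P).-tuple atom) : uniq s ->
  act p (vpint s) = vpint (map_tuple p s).
Proof.
move=> _; apply: vpred_eq => v /=; congr srel; apply: funext => i.
by rewrite /= tnth_map.
Qed.

Definition vinterp : interp S vfoleq :=
  @Interp S (term_tl S) vfoleq vfint vpint vfint_equiv vpint_equiv.

Lemma fext_eval v f (us : (far f).-tuple (term_tl S)) :
  teval v (fext vinterp us) = sfun (fun i => teval v (tnth us i)).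
Proof.
rewrite /fext (@ev_simsub S M (term_nom S) _ _ (fun t v => teval v t)).
- rewrite /=; congr sfun; apply: funext => i.
  by rewrite ffunE /= vupds_zip_map ?fresh_argsP.
- by move=> *; exact: teval_act.
- by move=> *; exact: teval_subst1.
- by move=> x a w d /fresh_term; apply: teval_upd_fresh.
- exact: fresh_argsP.
Qed.

Lemma pext_eval v P (us : (par P).-tuple (term_tl S)) :
  sval (pext vinterp us) v = srel (fun i => teval v (tnth us i)).
Proof.
rewrite [LHS]vsimsubE ?fresh_argsP //=; congr srel; apply: funext => i.
by rewrite vupds_zip_map ?fresh_argsP.
Qed.

(** Function symbols are interpreted by themselves, so a term denotes itself as far as values in [M]
    can tell. *)
Lemma tden_eval v (t : term S) : teval v (tden vinterp t) = teval v t.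
Proof.
elim/term_nested_ind: t => [a|f ts IH] //; rewrite [LHS]fext_eval /=.
by congr sfun; apply: funext => i; rewrite tnth_mktuple.
Qed.

(** Each operation of the algebra is pointwise the matching connective or quantifier, so an
    inequality between denotations is semantic consequence over [M]. *)
Lemma rden_sat v (F : rpred S) : sval (rden vinterp F) v = rsat v F.
Proof.
elim: F v => [|r s|P ts|F IF G IG|F IF|a F IF] v.
- exact: vbotE.
- by rewrite [LHS]veqE !tden_eval.
- rewrite [LHS]pext_eval /=; congr srel; apply: funext => i.
  by rewrite tnth_mktuple tden_eval.
- by rewrite [LHS]vmeetE IF IG.
- by rewrite /= IF.
- by rewrite [LHS]vallE; apply: eq_forall => d; rewrite IF.
Qed.

End PredicateAlgebra.

(** * Terms over finitely many function symbols *)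

Section FiniteSignature.
Variable S : signature.
Implicit Types (fs : seq (fsym S)) (t : term S) (F : rpred S).

Fixpoint tover fs t : bool :=
  match t with
  | TAtm _ => true
  | TApp f ts => (f \in fs) && [forall i, tover fs (ts i)]
  end.

Fixpoint rover fs F : bool :=
  match F with
  | RBot => true
  | REq r s => tover fs r && tover fs s
  | RRel P ts => [forall i, tover fs (ts i)]
  | RAnd F1 F2 => rover fs F1 && rover fs F2
  | RNot F1 => rover fs F1
  | RAll _ F1 => rover fs F1
  end.

Lemma tover_sub fs gs t : {subset fs <= gs} -> tover fs t -> tover gs t.
Proof.
move=> sub; elim/term_nested_ind: t => [a|f ts IH] //= /andP[/sub-> /forallP h].
by apply/forallP => i; apply: IH.
Qed.

Lemma rover_sub fs gs F : {subset fs <= gs} -> rover fs F -> rover gs F.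
Proof.
move=> sub; elim: F => [|r s|P ts|F IF G IG|F IF|a F IF] //=.
- by move=> /andP[/(tover_sub sub)-> /(tover_sub sub)->].
- by move=> /forallP h; apply/forallP => i; apply: tover_sub (h i).
- by move=> /andP[/IF-> /IG->].
Qed.

Lemma tover_ex_tuple n (ts : 'I_n -> term S) :
  (forall i, exists fs, tover fs (ts i)) -> exists fs, forall i, tover fs (ts i).
Proof.
move=> /choice[h hP]; exists (flatten [seq h i | i <- enum 'I_n]) => i.
apply: tover_sub (hP i) => f fi; apply/flatten_mapP.
by exists i => //; rewrite mem_enum.
Qed.

Lemma tover_ex t : exists fs, tover fs t.
Proof.
elim/term_nested_ind: t => [a|f ts IH]; first by exists [::].
have [fs hfs] := tover_ex_tuple IH; exists (f :: fs); rewrite /= mem_head /=.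
by apply/forallP => i; apply: tover_sub (hfs i) => g; rewrite inE orbC => ->.
Qed.

Lemma rover_ex F : exists fs, rover fs F.
Proof.
elim: F => [|r s|P ts|F [fs hF] G [gs hG]|F //|a F //]; first by exists [::].
- have [fs hr] := tover_ex r; have [gs hs] := tover_ex s; exists (fs ++ gs).
  rewrite /= (tover_sub _ hr) ?(tover_sub _ hs) // => f; rewrite mem_cat => -> //.
  by rewrite orbT.
- have [fs hfs] := tover_ex_tuple (fun i => tover_ex (ts i)).
  by exists fs; apply/forallP.
- exists (fs ++ gs); rewrite /= (rover_sub _ hF) ?(rover_sub _ hG) // => f.
    by rewrite mem_cat => ->; rewrite orbT.
  by rewrite mem_cat => ->.
Qed.

Lemma rover_ex_seq (l : seq (rpred S)) : exists fs, forall F, F \in l -> rover fs F.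
Proof.
elim: l => [|F l [fs hl]]; first by exists [::].
have [gs hF] := rover_ex F; exists (fs ++ gs) => G; rewrite inE => /orP[/eqP->|/hl hG].
  by apply: rover_sub hF => f; rewrite mem_cat => ->; rewrite orbT.
by apply: rover_sub hG => f; rewrite mem_cat => ->.
Qed.

Lemma tover_act fs p t : tover fs (tact p t) = tover fs t.
Proof.
elim/term_nested_ind: t => [a|f ts IH] //=; congr (_ && _).
by apply: eq_forallb => i; rewrite ffunE.
Qed.

Lemma rover_act fs p F : rover fs (ract p F) = rover fs F.
Proof.
elim: F => [|r s|P ts|F IF G IG|F IF|a F IF] //=; first by rewrite !tover_act.
  by apply: eq_forallb => i; rewrite ffunE tover_act.
by rewrite IF IG.
Qed.

Lemma rover_aeq fs F G : aeq F G -> rover fs F = rover fs G.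
Proof.
by elim=> //= [? ? ? _ -> _ ->|? ? ? ? _ -> _ ->|*] //; rewrite rover_act.
Qed.

Lemma tover_subst fs th t : (forall a, tover fs (th a)) -> tover fs t ->
  tover fs (tsubst th t).
Proof.
move=> hth; elim/term_nested_ind: t => [a|f ts IH] //= /andP[-> /forallP h] /=.
by apply/forallP => i; rewrite ffunE; apply: IH.
Qed.

Lemma rover_subst fs th F : (forall a, tover fs (th a)) -> rover fs F ->
  rover fs (rsubst th F).
Proof.
elim: F th => [|r s|P ts|F IF G IG|F IF|a F IF] th hth //=.
- by move=> /andP[hr hs]; rewrite !tover_subst.
- by move=> /forallP h; apply/forallP => i; rewrite ffunE tover_subst.
- by move=> /andP[hF hG]; rewrite IF ?IG.
- exact: IF.
- by apply: IF => b; rewrite /upd; case: eqP.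
Qed.

Lemma tover_upd fs a r b : tover fs r -> tover fs (upd TAtm a r b).
Proof. by rewrite /upd; case: eqP. Qed.

(** Every stage is a finite list: it adds one atom and all applications of symbols of [fs] to
    earlier terms. The default [TAtm 0] is never reached, as indices stay below [size T]. *)
Fixpoint terms_upto fs (n : nat) : seq (term S) :=
  if n is m.+1 then
    let T := terms_upto fs m in
    T ++ TAtm m ::
    flatten [seq [seq TApp [ffun i => nth (TAtm 0) T (h i)]
                 | h : {ffun 'I_(far f) -> 'I_(size T)}] | f : fsym S <- fs]
  else [::].

Lemma terms_upto_mono fs m n : (m <= n)%N -> {subset terms_upto fs m <= terms_upto fs n}.
Proof.
move=> /subnK <-; elim: (n - m)%N => [|k IH] t // /IH.
by rewrite addSn /= mem_cat => ->.
Qed.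

Lemma terms_upto_complete fs t : tover fs t -> exists n, t \in terms_upto fs n.
Proof.
elim/term_nested_ind: t => [a|f ts IH] /=.
  by move=> _; exists a.+1; rewrite /= mem_cat mem_head orbT.
move=> /andP[ffs /forallP h].
have [d hd] := choice (fun i => IH i (h i)).
(* All arguments are present at the latest of their stages. *)
pose N := \max_i d i.
have tsN i : ts i \in terms_upto fs N.
  by apply: terms_upto_mono (hd i); exact: leq_bigmax.
have ix i : (index (ts i) (terms_upto fs N) < size (terms_upto fs N))%N.
  by rewrite index_mem.
exists N.+1; rewrite /= mem_cat inE; apply/orP; right; apply/orP; right.
apply/flatten_mapP; exists f => //; apply/mapP; exists [ffun i => Ordinal (ix i)].
  by rewrite mem_enum.
by congr TApp; apply/ffunP => i; rewrite !ffunE /= nth_index.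
Qed.

(** A measure invariant under alpha-equivalence, renaming and substitution, so that instances of a
    quantified predicate count as smaller. *)
Fixpoint rsize F : nat :=
  match F with
  | RBot | REq _ _ | RRel _ _ => 0
  | RAnd F1 F2 => (maxn (rsize F1) (rsize F2)).+1
  | RNot F1 => (rsize F1).+1
  | RAll _ F1 => (rsize F1).+1
  end.

Lemma rsize_act p F : rsize (ract p F) = rsize F.
Proof. by elim: F => //= [F -> G ->|F ->|a F ->]. Qed.

Lemma rsize_aeq F G : aeq F G -> rsize F = rsize G.
Proof.
by elim=> //= [? ? ? _ -> _ ->|? ? ? ? _ -> _ ->|? ? _ ->|? ? ? _ ->|*] //; rewrite rsize_act.
Qed.

Lemma rsize_subst th F : rsize (rsubst th F) = rsize F.
Proof. by elim: F th => //= [F IF G IG|F IF|a F IF] th; rewrite ?IF ?IG. Qed.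

End FiniteSignature.

(** * Saturation of an underivable sequent *)

Section Saturation.
Variable S : signature.
Implicit Types (F G H : rpred S) (s : seq (rpred S) * seq (rpred S)).

Lemma pcls_and F G : pcls (RAnd F G) = pand (pcls F) (pcls G).
Proof. by apply: pclsP; apply: aeq_sym; apply: aeq_and; apply: repr_pcls. Qed.

Lemma pcls_not F : pcls (RNot F) = pnot (pcls F).
Proof. by apply: pclsP; apply: aeq_sym; apply: aeq_not; apply: repr_pcls. Qed.

Lemma pcls_all a F : pcls (RAll a F) = pall a (pcls F).
Proof. by apply: pclsP; apply: aeq_sym; apply: aeq_all; apply: repr_pcls. Qed.

Definition pcls_set (l : seq (rpred S)) : {fset pred_of S} :=
  foldr (fun F A => pcls F |` A) fset0 l.

Lemma mem_pcls_set l F : F \in l -> pcls F \in pcls_set l.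
Proof.
by elim: l => //= G l IH; rewrite !inE => /orP[/eqP->|/IH->]; rewrite ?eqxx ?orbT.
Qed.

Lemma pcls_setP l (A : pred_of S) : A \in pcls_set l -> exists2 F, F \in l & A = pcls F.
Proof.
elim: l => //= G l IH; rewrite !inE => /orP[/eqP->|/IH[F Fl ->]].
  by exists G; rewrite ?mem_head.
by exists F; rewrite // inE Fl orbT.
Qed.

(** Contexts are sets, so a predicate already present can be made principal and still remain in the
    premise. *)
Lemma pcls_setU1 l F : F \in l -> pcls F |` pcls_set l = pcls_set l.
Proof. by move=> Fl; apply: mem_fset1U; apply: mem_pcls_set. Qed.

(** * The rules read from conclusion to premises *)

Definition underivable s := ~ derivable (pcls_set s.1) (pcls_set s.2).

Lemma underivable_disjoint s F : underivable s -> F \in s.1 -> F \in s.2 -> False.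
Proof.
by move=> op F1 F2; apply: op; rewrite -(pcls_setU1 F1) -(pcls_setU1 F2); apply: d_hyp.
Qed.

Lemma underivable_bot s : underivable s -> RBot \in s.1 -> False.
Proof. by move=> op F1; apply: op; rewrite -(pcls_setU1 F1); apply: d_botL. Qed.

Lemma underivable_andL s F G : underivable s -> RAnd F G \in s.1 ->
  underivable ([:: F, G & s.1], s.2).
Proof.
move=> op FG d; apply: op; rewrite -(pcls_setU1 FG) pcls_and.
exact: d_andL.
Qed.

Lemma underivable_andR s F G : underivable s -> RAnd F G \in s.2 ->
  underivable (s.1, F :: s.2) \/ underivable (s.1, G :: s.2).
Proof.
move=> op FG; apply: contrapT => /not_orP[/contrapT dF /contrapT dG]; apply: op.
by rewrite -(pcls_setU1 FG) pcls_and; apply: d_andR.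
Qed.

Lemma underivable_notL s F : underivable s -> RNot F \in s.1 -> underivable (s.1, F :: s.2).
Proof.
move=> op Fs d; apply: op; rewrite -(pcls_setU1 Fs) pcls_not.
exact: d_notL.
Qed.

Lemma underivable_notR s F : underivable s -> RNot F \in s.2 -> underivable (F :: s.1, s.2).
Proof.
move=> op Fs d; apply: op; rewrite -(pcls_setU1 Fs) pcls_not.
exact: d_notR.
Qed.

(** [psubst] acts on a chosen representative, which may differ from [F] by alpha-equivalence; hence
    later conditions on instances hold only up to [aeq]. *)
Lemma underivable_allL s a F r : underivable s -> RAll a F \in s.1 ->
  underivable (rsubst (upd TAtm a r) (repr (pcls F)) :: s.1, s.2).
Proof.
move=> op Fs d; apply: op; rewrite -(pcls_setU1 Fs) pcls_all.
exact: (@d_allL _ _ _ _ _ r).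
Qed.

(** [a] may be free in the context, so the bound atom is first renamed to one free nowhere in the
    sequent; the class of the principal predicate stays the same. *)
Lemma underivable_allR s a F : underivable s -> RAll a F \in s.2 ->
  exists2 c, c \notin rfv F & underivable (s.1, ract (swap c a) F :: s.2).
Proof.
move=> op Fs.
pose A := \bigcup_(G <- RAll a F :: F :: s.1 ++ s.2) rfv G.
have fr G : G \in [:: RAll a F, F & s.1 ++ s.2] -> new_atom A \notin rfv G.
  by move=> Gl; apply: contraNN (new_atomP A) => h; apply/bigfcupP; exists G => //; rewrite Gl.
have cF : new_atom A \notin rfv F by apply: fr; rewrite !inE eqxx orbT.
exists (new_atom A) => // d; apply: op.
rewrite -(pcls_setU1 Fs) (pclsP (aeq_rename a cF)) pcls_all; apply: d_allR d => G.
suff h l : {subset l <= s.1 ++ s.2} -> G \in pcls_set l -> new_atom A \notin pfv G.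
  by rewrite inE => /orP[]; apply: h => H Hs; rewrite mem_cat Hs ?orbT.
move=> ls /pcls_setP[H /ls Hs ->]; rewrite /pfv (rfv_aeq (repr_pcls H)).
by apply: fr; rewrite !inE Hs !orbT.
Qed.

Lemma underivable_eqR s r : underivable s -> underivable (REq r r :: s.1, s.2).
Proof. by move=> op d; apply: op; apply: (@d_eqR _ _ _ r). Qed.

(** For atomic [F] the representative is [F] itself, so the replacement is computed on the
    syntax. *)
Lemma underivable_eqL s r r' a F : underivable s -> atomic F -> REq r' r \in s.1 ->
  rsubst (upd TAtm a r) F \in s.1 -> underivable (rsubst (upd TAtm a r') F :: s.1, s.2).
Proof.
move=> op atF E1 F1 d; apply: op.
have reprF : repr (pcls F) = F.
  by apply: aeq_atomic (repr_pcls F) _; rewrite atF orbT.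
rewrite -(pcls_setU1 F1) -(pcls_setU1 E1).
have /(@d_eqL _ _ _ r r' a (pcls F)) :
    derivable (psubst (pcls F) a r' |` (peq r' r |` pcls_set s.1)) (pcls_set s.2).
  by rewrite /psubst reprF [_ |` pcls_set s.1](pcls_setU1 E1).
by rewrite /psubst reprF.
Qed.

(** * Replacement of equals in atomic predicates *)

Definition ffrep n (ts : {ffun 'I_n -> term S}) (i : 'I_n) (r : term S) :
  {ffun 'I_n -> term S} := [ffun j => if j == i then r else ts j].

Lemma ffrep_id n (ts : {ffun 'I_n -> term S}) i : ffrep ts i (ts i) = ts.
Proof. by apply/ffunP => j; rewrite ffunE; case: eqP => // ->. Qed.

Lemma tsubst_ffrep n (ts : {ffun 'I_n -> term S}) i a r :
  (forall j, a \notin tfv (ts j)) ->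
  [ffun j => tsubst (upd TAtm a r) (ffrep ts i (TAtm a) j)] = ffrep ts i r.
Proof.
move=> fr; apply/ffunP => j; rewrite !ffunE; case: eqP => _; last exact: tsubst_fresh.
by rewrite /= /upd eqxx.
Qed.

(** One-step replacements of [r] by [r']: the whole right-hand side of an equation, one argument
    there, or one argument of a relation. The first kind yields symmetry and transitivity, the
    others congruence. *)
Definition eqreps E G : seq (rpred S) :=
  match E, G with
  | REq r' r, REq u t =>
      (if t == r then [:: REq u r'] else [::]) ++
      (if t is TApp f ts then
         [seq REq u (TApp (ffrep ts i r')) | i <- enum 'I_(far f) & ts i == r]
       else [::])
  | REq r' r, RRel P ts =>
      [seq RRel (ffrep ts i r') | i <- enum 'I_(par P) & ts i == r]
  | _, _ => [::]
  end.

Lemma mem_eqreps_eq r' r u : REq u r' \in eqreps (REq r' r) (REq u r).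
Proof. by rewrite /= eqxx mem_head. Qed.

Lemma mem_eqreps_app r' u f (ts : {ffun 'I_(far f) -> term S}) i :
  REq u (TApp (ffrep ts i r')) \in eqreps (REq r' (ts i)) (REq u (TApp ts)).
Proof.
rewrite [eqreps _ _]/= mem_cat; apply/orP; right; apply/mapP; exists i => //.
by rewrite mem_filter eqxx mem_enum.
Qed.

Lemma mem_eqreps_rel r' P (ts : {ffun 'I_(par P) -> term S}) i :
  RRel (ffrep ts i r') \in eqreps (REq r' (ts i)) (RRel ts).
Proof. by apply/mapP; exists i => //; rewrite mem_filter eqxx mem_enum. Qed.

(** A fresh atom [a] marks the occurrence to be replaced: substituting [r] for it restores [G],
    substituting [r'] gives [H]. *)
Lemma underivable_eqreps s E G H : underivable s -> E \in s.1 -> G \in s.1 ->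
  H \in eqreps E G -> underivable (H :: s.1, s.2).
Proof.
case: E => // r' r op E1; case: G => // [u t|P ts] G1.
  have [a au at_] : exists2 a, a \notin tfv u & a \notin tfv t.
    have := new_atomP (tfv u `|` tfv t); rewrite inE negb_or => /andP[].
    by exists (new_atom (tfv u `|` tfv t)).
  rewrite /= mem_cat => /orP[|].
    case: eqP => // tr; rewrite inE => /eqP->.
    have := @underivable_eqL s r r' a (REq u (TAtm a)) op isT E1.
    by rewrite /= !tsubst_fresh // /upd eqxx -tr; apply.
  case: t G1 at_ => // f ts G1 /= at_ /mapP[i].
  rewrite mem_filter => /andP[/eqP tsi _] ->.
  have fr j : a \notin tfv (ts j).
    by apply: contraNN at_ => h; apply/mem_bigcup_enum; exists j.
  have := @underivable_eqL s r r' a (REq u (TApp (ffrep ts i (TAtm a)))) op isT E1.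
  rewrite /= !(tsubst_fresh _ au) !tsubst_ffrep //; apply.
  by rewrite -tsi ffrep_id.
pose a := new_atom (rfv (RRel ts)).
have fr j : a \notin tfv (ts j).
  apply: contraNN (new_atomP (rfv (RRel ts))) => h.
  by apply/mem_bigcup_enum; exists j.
rewrite /= => /mapP[i]; rewrite mem_filter => /andP[/eqP tsi _] ->.
have := @underivable_eqL s r r' a (RRel (ffrep ts i (TAtm a))) op isT E1.
rewrite /= !tsubst_ffrep //; apply.
by rewrite -tsi ffrep_id.
Qed.

(** * Stages of the saturation *)

Definition sle s s' := {subset s.1 <= s'.1} /\ {subset s.2 <= s'.2}.

Lemma sle_refl s : sle s s. Proof. by split. Qed.

Lemma sle_trans s s' s'' : sle s s' -> sle s' s'' -> sle s s''.
Proof. by move=> [a b] [c d]; split=> F; [move/a/c|move/b/d]. Qed.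

Lemma sle_consl s F : sle s (F :: s.1, s.2).
Proof. by split=> G // Gs; rewrite inE Gs orbT. Qed.

Lemma sle_consr s F : sle s (s.1, F :: s.2).
Proof. by split=> G // Gs; rewrite inE Gs orbT. Qed.

(** Finitely many demands are met one after the other; monotonicity preserves those already met. *)
Lemma achieve_all (A : eqType) (l : seq A) (Q : A -> _ -> Prop) s0 :
  (forall x s s', Q x s -> sle s s' -> Q x s') ->
  (forall x s, x \in l -> sle s0 s -> underivable s ->
     exists s', [/\ sle s s', underivable s' & Q x s']) ->
  underivable s0 -> exists s, [/\ sle s0 s, underivable s & forall x, x \in l -> Q x s].
Proof.
move=> mono; elim: l => [|x l IH] step op; first by exists s0; split=> //; apply: sle_refl.
have [y s yl|//|s1 [le1 op1 h1]] := IH; first by apply: step; rewrite inE yl orbT.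
have [|s2 [le2 op2 h2]] := step x s1 _ le1 op1; first exact: mem_head.
exists s2; split=> //; first exact: sle_trans le2.
by move=> y; rewrite inE => /orP[/eqP->//|/h1 /mono]; apply.
Qed.

(** [T] and [Phi] bound the instances and replacements, so that one stage adds finitely many
    predicates; along the chain both lists grow. *)
Definition left_done (T : seq (term S)) (Phi : seq (rpred S)) F s : Prop :=
  match F with
  | RAnd F1 F2 => F1 \in s.1 /\ F2 \in s.1
  | RNot F1 => F1 \in s.2
  | RAll a F1 => forall r, r \in T ->
      exists2 F0, aeq F0 F1 & rsubst (upd TAtm a r) F0 \in s.1
  | REq _ _ => forall G, G \in Phi -> forall H, H \in eqreps F G -> H \in s.1
  | _ => True
  end.

Definition right_done F s : Prop :=
  match F with
  | RAnd F1 F2 => F1 \in s.2 \/ F2 \in s.2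
  | RNot F1 => F1 \in s.1
  | RAll a F1 => exists2 c, c \notin rfv F1 & ract (swap c a) F1 \in s.2
  | _ => True
  end.

Lemma left_done_mono T Phi F s s' :
  left_done T Phi F s -> sle s s' -> left_done T Phi F s'.
Proof.
move=> + [s1 s2]; case: F => [|r u|P ts|F1 F2|F1|a F1] //=.
- by move=> h G GP H HE; apply/s1/(h G).
- by case=> /s1 ? /s1.
- exact: s2.
- by move=> h r /h[F0 e /s1]; exists F0.
Qed.

Lemma right_done_mono F s s' : right_done F s -> sle s s' -> right_done F s'.
Proof.
move=> + [s1 s2]; case: F => [|r u|P ts|F1 F2|F1|a F1] //=.
- by case=> /s2; [left|right].
- exact: s1.
- by move=> [c e /s2]; exists c.
Qed.

Lemma saturate_left T s0 : underivable s0 ->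
  exists s, [/\ sle s0 s, underivable s & forall F, F \in s0.1 -> left_done T s0.1 F s].
Proof.
apply: achieve_all => [F s s'|]; first exact: left_done_mono.
case=> [|r u|P ts|F1 F2|F1|a F1] s Fs le op /=; try by exists s; split=> //; apply: sle_refl.
- pose L := flatten [seq eqreps (REq r u) G | G <- s0.1].
  have [||s' [le' op' h']] := @achieve_all _ L (fun H s => H \in s.1) s _ _ op.
  + by move=> H s1 s2 h [/(_ H h)].
  + move=> H s1 /flatten_mapP[G Gs HE] le1 op1; exists (H :: s1.1, s1.2).
    split; [exact: sle_consl| |exact: mem_head].
    have [/(_ _ Fs) F1 _] := sle_trans le le1; have [/(_ _ Gs) G1 _] := sle_trans le le1.
    exact: underivable_eqreps HE.
  + exists s'; split=> // G Gs H HE; apply: h'; apply/flatten_mapP; by exists G.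
- exists ([:: F1, F2 & s.1], s.2); split.
  + by apply: sle_trans (sle_consl (_, _) F1); apply: sle_consl.
  + by apply: underivable_andL => //; apply: le.1.
  + by rewrite !inE !eqxx !orbT.
- exists (s.1, F1 :: s.2); split; [exact: sle_consr| |exact: mem_head].
  by apply: underivable_notL => //; apply: le.1.
- have [||s' [le' op' h']] := @achieve_all _ T (fun r s =>
      exists2 F0, aeq F0 F1 & rsubst (upd TAtm a r) F0 \in s.1) s _ _ op.
  + by move=> r s1 s2 [F0 e h] [/(_ _ h) h' _]; exists F0.
  + move=> r s1 rT le1 op1; exists (rsubst (upd TAtm a r) (repr (pcls F1)) :: s1.1, s1.2).
    split; first exact: sle_consl.
      by apply: underivable_allL => //; apply: le1.1; apply: le.1.
    by exists (repr (pcls F1)); [apply: repr_pcls|rewrite mem_head].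
  + by exists s'.
Qed.

Lemma saturate_right s0 : underivable s0 ->
  exists s, [/\ sle s0 s, underivable s & forall F, F \in s0.2 -> right_done F s].
Proof.
apply: achieve_all => [F s s'|]; first exact: right_done_mono.
case=> [|r u|P ts|F1 F2|F1|a F1] s Fs [_ /(_ _ Fs) F2s] op /=;
  try by exists s; split=> //; apply: sle_refl.
- have [op'|op'] := underivable_andR op F2s.
    by exists (s.1, F1 :: s.2); split=> //; [exact: sle_consr|left; exact: mem_head].
  by exists (s.1, F2 :: s.2); split=> //; [exact: sle_consr|right; exact: mem_head].
- exists (F1 :: s.1, s.2); split; [exact: sle_consl| |exact: mem_head].
  exact: underivable_notR.
- have [c cF op'] := underivable_allR op F2s.
  exists (s.1, ract (swap c a) F1 :: s.2); split=> //; first exact: sle_consr.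
  by exists c; rewrite ?mem_head.
Qed.

Lemma saturate_refl (T : seq (term S)) s0 : underivable s0 ->
  exists s, [/\ sle s0 s, underivable s & forall r, r \in T -> REq r r \in s.1].
Proof.
apply: achieve_all => [r s s' h [/(_ _ h)]|r s rT le op] //.
by exists (REq r r :: s.1, s.2); split;
  [exact: sle_consl|exact: underivable_eqR|exact: mem_head].
Qed.

Definition saturates (T : seq (term S)) s s' :=
  [/\ sle s s', forall F, F \in s.1 -> left_done T s.1 F s',
      forall F, F \in s.2 -> right_done F s' & forall r, r \in T -> REq r r \in s'.1].

Lemma saturate T s : underivable s -> exists2 s', underivable s' & saturates T s s'.
Proof.
move=> /(saturate_left T)[s1 [le1 op1 h1]].
have [s2 [le2 op2 h2]] := saturate_right op1.
have [s3 [le3 op3 h3]] := saturate_refl T op2.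
have le13 := sle_trans le2 le3.
exists s3 => //; split=> //; first exact: sle_trans le13.
  by move=> F /h1 /left_done_mono; apply.
by move=> F /(le1.2) /h2 /right_done_mono; apply.
Qed.

Lemma saturation_chain (T : nat -> seq (term S)) s0 : underivable s0 ->
  exists st : nat -> _, [/\ st 0 = s0, forall n, underivable (st n)
    & forall n, saturates (T n) (st n) (st n.+1)].
Proof.
move=> op0.
(* The stage number is carried along because the list of terms depends on it; iterating the choice
   function yields the chain. *)
have step (x : nat * {s | underivable s}) : exists y : {s | underivable s},
    saturates (T x.1) (sval x.2) (sval y).
  case: x => n [s op] /=.
  by have [s' op' sat] := saturate (T n) op; exists (exist _ s' op').
have [h hP] := choice step.
pose st := nat_rect (fun=> {s | underivable s}) (exist _ s0 op0) (fun n x => h (n, x)).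
exists (fun n => sval (st n)); split=> // n; first exact: svalP.
exact: (hP (n, st n)).
Qed.

End Saturation.

(** * The term model of a saturated pair *)

(** The closure conditions only lead from a predicate to its parts, instances and replacements. The
    pair may leave predicates undecided: deciding an arbitrary one would amount to a cut. *)
Record hintikka S (fs : seq (fsym S)) (Gam Del : rpred S -> Prop) : Prop := Hintikka {
  hin_disjoint : forall F, Gam F -> ~ Del F;
  hin_bot : ~ Gam RBot;
  hin_andL : forall F G, Gam (RAnd F G) -> Gam F /\ Gam G;
  hin_andR : forall F G, Del (RAnd F G) -> Del F \/ Del G;
  hin_notL : forall F, Gam (RNot F) -> Del F;
  hin_notR : forall F, Del (RNot F) -> Gam F;
  hin_allL : forall a F r, Gam (RAll a F) -> tover fs r ->
    exists2 F0, aeq F0 F & Gam (rsubst (upd TAtm a r) F0);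
  hin_allR : forall a F, Del (RAll a F) ->
    exists2 c, c \notin rfv F & Del (ract (swap c a) F);
  hin_refl : forall r, tover fs r -> Gam (REq r r);
  hin_reps : forall E G H, Gam E -> Gam G -> H \in eqreps E G -> Gam H
}.

Lemma hintikka_ex S fs (s : seq (rpred S) * seq (rpred S)) : underivable s ->
  exists Gam Del, [/\ hintikka fs Gam Del, forall F, F \in s.1 -> Gam F
    & forall F, F \in s.2 -> Del F].
Proof.
move=> /(saturation_chain (terms_upto fs))[st [st0 op sat]].
exists (fun F => exists n, F \in (st n).1), (fun F => exists n, F \in (st n).2).
have le m n : (m <= n)%N -> sle (st m) (st n).
  move=> /subnK <-; elim: (n - m)%N => [|k IH]; first exact: sle_refl.
  by apply: sle_trans IH _; case: (sat (k + m)%N).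
have leL m n F : F \in (st m).1 -> (m <= n)%N -> F \in (st n).1.
  by move=> Fm /le[h _]; apply: h.
have leR m n F : F \in (st m).2 -> (m <= n)%N -> F \in (st n).2.
  by move=> Fm /le[_ h]; apply: h.
have doneL n F : F \in (st n).1 -> left_done (terms_upto fs n) (st n).1 F (st n.+1).
  by case: (sat n) => _ h _ _; apply: h.
have doneR n F : F \in (st n).2 -> right_done F (st n.+1).
  by case: (sat n) => _ _ h _; apply: h.
split; [split|by move=> F Fs; exists 0; rewrite st0|by move=> F Fs; exists 0; rewrite st0].
(* Occurrences from different stages meet at the later one, which is underivable. *)
- move=> F [m Fm] [n Fn]; apply: (@underivable_disjoint _ (st (maxn m n)) F) => //.
    by apply: leL Fm _; apply: leq_maxl.
  by apply: leR Fn _; apply: leq_maxr.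
- by move=> [n /(underivable_bot (op n))].
- by move=> F G [n /doneL[hF hG]]; split; exists n.+1.
- by move=> F G [n /doneR[h|h]]; [left|right]; exists n.+1.
- by move=> F [n /doneL h]; exists n.+1.
- by move=> F [n /doneR h]; exists n.+1.
- move=> a F r [m Fm] /terms_upto_complete[n rn].
  (* At the later of the two stages both predicate and term are available, so the next stage
     contains the instance. *)
  have /doneL/(_ r)[|F0 e h] := leL _ _ _ Fm (leq_maxl m n).
    by apply: terms_upto_mono rn; apply: leq_maxr.
  by exists F0 => //; exists (maxn m n).+1.
- by move=> a F [n /doneR[c cF h]]; exists c => //; exists n.+1.
- move=> r /terms_upto_complete[n rn]; exists n.+1.
  by case: (sat n) => _ _ _; apply.
- case=> // r u G H [m Em] [n Gn] HE; exists (maxn m n).+1.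
  have /doneL /= h := leL _ _ _ Em (leq_maxl m n).
  by apply: h HE; apply: leL Gn _; apply: leq_maxr.
Qed.

Section TermModel.
Variables (S : signature) (fs : seq (fsym S)) (Gam Del : rpred S -> Prop).
Hypothesis hin : hintikka fs Gam Del.

(** The first equation rewrites the right-hand side of the second. With reflexivity, this Euclidean
    law gives symmetry and transitivity. *)
Lemma hin_euclid r u t : Gam (REq r u) -> Gam (REq t u) -> Gam (REq t r).
Proof. by move=> ru tu; apply: (hin_reps hin ru tu); apply: mem_eqreps_eq. Qed.

Lemma hin_sym r u : tover fs u -> Gam (REq r u) -> Gam (REq u r).
Proof. by move=> /(hin_refl hin) uu ru; apply: hin_euclid ru uu. Qed.

Lemma ffrep_all n (K : {ffun 'I_n -> term S} -> Prop) (ts us : {ffun 'I_n -> term S}) :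
  (forall (ts : {ffun 'I_n -> term S}) i r,
     Gam (REq r (ts i)) -> K ts -> K (ffrep ts i r)) ->
  (forall i, Gam (REq (us i) (ts i))) -> K ts -> K us.
Proof.
move=> step eqs Kts.
(* The hybrids lead from [ts] to [us], changing one argument at a time. *)
pose mix k : {ffun 'I_n -> term S} := [ffun j : 'I_n => if (j < k)%N then us j else ts j].
suff Kmix k : (k <= n)%N -> K (mix k).
  have <- : mix n = us by apply/ffunP => j; rewrite ffunE ltn_ord.
  exact: Kmix.
elim: k => [_|k IH kn]; first by rewrite (_ : mix 0 = ts) //; apply/ffunP => j; rewrite ffunE.
pose i := Ordinal kn.
rewrite (_ : mix k.+1 = ffrep (mix k) i (us i)); last first.
  apply/ffunP => j; rewrite !ffunE ltnS leq_eqVlt -val_eqE /=.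
  by case: eqVneq => [e|] //=; congr (us _); apply: val_inj.
by apply: step; [rewrite ffunE ltnn|apply: IH; apply: ltnW].
Qed.

(* Terms with symbols outside [fs] are never instantiated, so they are collapsed
   to an atom. *)
Definition retract (t : term S) : term S := if tover fs t then t else TAtm 0.

Lemma tover_retract t : tover fs (retract t).
Proof. by rewrite /retract; case: ifP. Qed.

Lemma retract_id t : tover fs t -> retract t = t.
Proof. by rewrite /retract => ->. Qed.

Definition teqv : rel (term S) := fun r u => `[< Gam (REq (retract r) (retract u)) >].

Lemma teqv_refl : reflexive teqv.
Proof. by move=> r; apply/asboolP; apply: (hin_refl hin); apply: tover_retract. Qed.

Lemma teqv_sym : symmetric teqv.
Proof. by move=> r u; apply/asboolP/asboolP; apply: hin_sym; apply: tover_retract. Qed.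

Lemma teqv_trans : transitive teqv.
Proof.
move=> u r t /asboolP ru /asboolP ut; apply/asboolP.
by apply: hin_euclid ru; apply: hin_sym ut; apply: tover_retract.
Qed.

Definition teqv_equiv := EquivRel teqv teqv_refl teqv_sym teqv_trans.
Definition tmodel_dom := {eq_quot teqv_equiv}%qT.
Definition tcls (t : term S) : tmodel_dom := (\pi_(tmodel_dom) t)%qT.
(** Retracting puts the representative over [fs], where instances are available. *)
Definition trepr (d : tmodel_dom) : term S := retract (repr d).

Lemma tclsP r u : tover fs r -> tover fs u -> tcls r = tcls u <-> Gam (REq r u).
Proof.
move=> hr hu; rewrite -{2}(retract_id hr) -{2}(retract_id hu).
by split=> [/eqquotP /asboolP //|h]; apply/eqquotP/asboolP.
Qed.

Lemma tcls_retract t : tcls (retract t) = tcls t.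
Proof.
apply/eqquotP/asboolP; rewrite retract_id ?tover_retract //.
exact/(hin_refl hin)/tover_retract.
Qed.

Lemma treprK d : tcls (trepr d) = d.
Proof. by rewrite tcls_retract /tcls reprK. Qed.

Lemma tover_trepr d : tover fs (trepr d).
Proof. exact: tover_retract. Qed.

Lemma trepr_tcls t : tover fs t -> Gam (REq (trepr (tcls t)) t).
Proof. by move=> ht; apply/tclsP; rewrite ?tover_trepr ?treprK. Qed.

(** Symbols act on chosen representatives; congruence is invoked only when a term or relation is
    compared with its version on representatives. *)
Definition tmodel : structure S := @Structure S tmodel_dom
  (fun f ds => tcls (TApp [ffun i => trepr (ds i)]))
  (fun P ds => Gam (RRel [ffun i => trepr (ds i)])).

Definition tval0 : atom -> dom tmodel := fun a => tcls (TAtm a).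

Lemma teval_tcls t : tover fs t -> teval tval0 t = tcls t.
Proof.
elim/term_nested_ind: t => [a|f ts IH] //= /andP[ffs /forallP hts].
have hrep : tover fs (TApp [ffun i => trepr (teval tval0 (ts i))]).
  by rewrite /= ffs; apply/forallP => i; rewrite ffunE tover_trepr.
have happ : tover fs (TApp ts) by rewrite /= ffs; apply/forallP.
apply/esym/tclsP => //.
(* Starting from reflexivity, the arguments on the right are exchanged for their representatives. *)
apply: (@ffrep_all _ (fun us => Gam (REq (TApp ts) (TApp us))) ts); last exact: (hin_refl hin).
  by move=> us i r ri usK; apply: (hin_reps hin ri usK); apply: mem_eqreps_app.
by move=> i; rewrite ffunE IH //; apply: trepr_tcls.
Qed.

Lemma truth_atomic F : atomic F -> rover fs F ->
  (Gam F -> rsat tval0 F) /\ (Del F -> ~ rsat tval0 F).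
Proof.
case: F => [|r u|P ts|//|//|//] _ /=.
- by move=> _; split=> [|_ []]; exact: (hin_bot hin).
- move=> /andP[hr hu]; rewrite !teval_tcls //; split=> [/(tclsP hr hu)//|d].
  by move=> /(tclsP hr hu) h; apply: (hin_disjoint hin) d.
- move=> /forallP hts.
  have e i : Gam (REq (trepr (teval tval0 (ts i))) (ts i)).
    by rewrite teval_tcls //; apply: trepr_tcls.
  have step (us : {ffun 'I_(par P) -> term S}) i r :
      Gam (REq r (us i)) -> Gam (RRel us) -> Gam (RRel (ffrep us i r)).
    by move=> ri usK; apply: (hin_reps hin ri usK); apply: mem_eqreps_rel.
  (* Truth of a left relation passes from the arguments to their representatives; for a right one,
     the way back contradicts disjointness. *)
  split=> [h|d h]; first by apply: ffrep_all step _ h => i; rewrite ffunE.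
  apply: (hin_disjoint hin) d; apply: ffrep_all step _ h => i.
  by rewrite ffunE; apply: hin_sym (e i).
Qed.

(** Both halves go together because negation exchanges the sides. The induction is on size, since
    instances and renamings are not subpredicates. *)
Lemma truth F : rover fs F ->
  (Gam F -> rsat tval0 F) /\ (Del F -> ~ rsat tval0 F).
Proof.
move: {2}(rsize F) (leqnn (rsize F)) => n.
elim: n F => [|n IHn] F; first by case: F => // *; apply: truth_atomic.
have [atF _|] := boolP (atomic F); first exact: truth_atomic.
case: F => // [F G|F|a F] _ /= sz.
- move: sz; rewrite ltnS geq_max => /andP[sF sG] /andP[oF oG].
  have [F1 F2] := IHn F sF oF; have [G1 G2] := IHn G sG oG; split.
    by move=> /(hin_andL hin)[/F1 ? /G1 ?].
  by move=> /(hin_andR hin)[/F2|/G2] h [].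
- move=> oF; have [F1 F2] := IHn F sz oF; split; first by move/(hin_notL hin)/F2.
  by move=> /(hin_notR hin)/F1 h; apply.
- move=> oF; split=> [h d|/(hin_allR hin)[c cF h] sat].
    (* Every element [d] is the value of the term [trepr d] over [fs], so the instances in [Gam]
       cover the whole domain. *)
    have [F0 e h0] := hin_allL hin h (tover_trepr d).
    have := (IHn (rsubst (upd TAtm a (trepr d)) F0) _ _).1 h0.
    rewrite rsize_subst (rsize_aeq e) rsat_subst1 (rsat_aeq e).
    rewrite teval_tcls ?tover_trepr // treprK; apply=> //.
    apply: rover_subst; last by rewrite (rover_aeq _ e).
    by move=> b; apply: tover_upd; apply: tover_trepr.
  apply: ((IHn (ract (swap c a) F) _ _).2 h); rewrite ?rsize_act ?rover_act //.
  (* The value of the eigenvariable [c] is the counterexample to the quantifier. *)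
  by rewrite -[tval0](vupd_id _ c) rsat_swap.
Qed.

End TermModel.

(** * Completeness *)

Lemma In_mem (T : eqType) (x : T) (l : seq T) : List.In x l <-> x \in l.
Proof.
elim: l => [|y l IH] //=; rewrite inE; split=> [[->|/IH->]|/orP[/eqP->|/IH]].
- by rewrite eqxx.
- by rewrite orbT.
- by left.
- by right.
Qed.

Theorem theorem7p34 (S : signature) (Phi Psi : {fset pred_of S}) :
  (forall (U : termlike) (L : foleq U) (I : interp S L),
     fle (flim fset0 [seq pden I F | F <- Phi])
         (fcolim fset0 [seq pden I F | F <- Psi])) ->
  derivable Phi Psi.
Proof.
move=> valid; apply: contrapT => nd.
have repr_set (A : {fset pred_of S}) : pcls_set [seq repr F | F <- A] = A.
  apply/fsetP => F; apply/idP/idP => [/pcls_setP[_ /mapP[G GA ->] ->]|FA].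
    by rewrite /pcls reprK.
  by rewrite -(reprK F); apply: mem_pcls_set; apply: map_f.
pose s := ([seq repr F | F <- Phi], [seq repr F | F <- Psi]).
have op : underivable s by rewrite /underivable !repr_set.
have [fs hfs] := rover_ex_seq (s.1 ++ s.2).
have [Gam [Del [hin Gs Ds]]] := hintikka_ex fs op.
have := valid _ _ (vinterp (tmodel hin)) (tval0 hin).
(* Validity at [tval0] is refuted in two goals: every left predicate holds there, and no right
   predicate does. *)
rewrite vlim0E vcolim0E => -[x|x] /List.in_map_iff[F [<- /In_mem FA]].
  have Fs : repr F \in s.1 by apply: map_f.
  rewrite rden_sat; apply: (truth hin (hfs _ _)).1; last exact: Gs.
  by rewrite mem_cat Fs.
have Fs : repr F \in s.2 by apply: map_f.
rewrite rden_sat; apply: (truth hin (hfs _ _)).2; last exact: Ds.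
by rewrite mem_cat Fs orbT.
Qed.
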